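(* Let $q>0$ and let $\mathcal{A}=\mathbb{C}\langle a,a^*\mid aa^*=qa^*a+\mathbf 1\rangle$ be the $q$-oscillator $*$-algebra, with the $\mathbb{Z}$-grading determined by $a\in\mathcal{A}_1$, $a^*\in\mathcal{A}_{-1}$. There exists a (non-degenerate) $*$-representation $\pi$ of $\mathcal{A}$ which cannot be extended to a well-behaved $*$-representation in a possibly larger Hilbert space; that is, there is no well-behaved $*$-representation $\tilde\pi$ of $\mathcal{A}$ on a Hilbert space $\mathcal{H}_{\tilde\pi}$ containing $\mathcal{H}_\pi$ as a Hilbert subspace such that $\mathcal{D}(\pi)\subseteq\mathcal{D}(\tilde\pi)$ and $\tilde\pi(x)\varphi=\pi(x)\varphi$ for all $x\in\mathcal{A}$, $\varphi\in\mathcal{D}(\pi)$.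
   Context: **$*$-representations.** A $*$-representation $\pi$ of a unital $*$-algebra $\mathcal{A}$ on a dense linear subspace $\mathcal{D}(\pi)$ of a Hilbert space $\mathcal{H}_\pi$ is an algebra homomorphism from $\mathcal{A}$ into the linear operators $\mathcal{D}(\pi)\to\mathcal{D}(\pi)$ with $\langle\pi(x)\varphi,\psi\rangle=\langle\varphi,\pi(x^* )\psi\rangle$ for $\varphi,\psi\in\mathcal{D}(\pi)$, $x\in\mathcal{A}$. The graph topology on $\mathcal{D}(\pi)$ is given by the norms $\varphi\mapsto\|\varphi\|+\|\pi(x)\varphi\|$, $x\in\mathcal{A}$. $\pi$ is closed if $\mathcal{D}(\pi)$ is complete in it. $\pi$ is non-degenerate if the span of $\{\pi(x)\varphi\}$ is dense in $\mathcal{D}(\pi)$ in the graph topology; for unital $\mathcal{A}$ this implies $\pi(\mathbf 1)\varphi=\varphi$ for all $\varphi\in\mathcal{D}(\pi)$. **Partial action.** $\mathcal{B}:=\mathcal{A}_0$ is commutative. $\widehat{\mathcal{B}}$ is the set of characters (nonzero $*$-homomorphisms $\mathcal{B}\to\mathbb{C}$), with the weak topology defined by the functions $\widehat b(\chi)=\chi(b)$, $b\in\mathcal B$, and its Borel structure. $\widehat{\mathcal{B}}^+$ is the set of $\chi\in\widehat{\mathcal{B}}$ with $\chi(c^*c)\ge0$ for all homogeneous $c\in\bigcup_n\mathcal{A}_n$. For $n\in\mathbb{Z}$, $\mathcal{D}_{-n}$ is the set of $\chi\in\widehat{\mathcal{B}}^+$ with $\chi(c^*c)\neq0$ for some $c\in\mathcal{A}_n$,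 and $\alpha_n:\mathcal{D}_{-n}\to\mathcal{D}_n$ is $(\alpha_n(\chi))(b)=\chi(c^*bc)/\chi(c^*c)$, $b\in\mathcal{B}$, for any such $c$ (independent of the choice). **Well-behaved.** A closed $*$-representation $\pi$ of $\mathcal{A}$ is well-behaved if: (i) the restriction of $\pi$ to $\mathcal{B}$ is integrable (i.e. $\overline{\pi(b)}$ is normal for every $b\in\mathcal{B}$) and there is a spectral measure $E_\pi$ on $\widehat{\mathcal{B}}^+$ with $\overline{\pi(b)}=\int_{\widehat{\mathcal{B}}^+}\widehat b(\chi)\,dE_\pi(\chi)$ for $b\in\mathcal{B}$; (ii) for all $n\in\mathbb{Z}$, $c\in\mathcal{A}_n$ and Borel $\Delta\subseteq\widehat{\mathcal{B}}^+$, $\pi(c)E_\pi(\Delta)\supseteq E_\pi(\alpha_n(\Delta\cap\mathcal{D}_{-n}))\pi(c)$. *)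

(* Defs.v *)
From HB Require Import structures.
From mathcomp Require Import all_boot all_order all_algebra.
From mathcomp Require Import sesquilinear generic_quotient.
From mathcomp Require Import all_classical all_reals all_analysis.
From mathcomp Require Import complex.

Set Implicit Arguments.
Unset Strict Implicit.
Unset Printing Implicit Defensive.

Import Order.TTheory GRing.Theory Num.Theory.
Import numFieldNormedType.Exports.

Local Open Scope classical_set_scope.
Local Open Scope ring_scope.
Local Open Scope quotient_scope.

HB.mixin Record isStarAlgebra (C : numClosedFieldType) A & GRing.Algebra C A := {
  star : A -> A;
  starK : involutive star;
  starD : {morph star : x y / x + y};
  starZ : forall (c : C) (x : A), star (c *: x) = c^* *: star x;
  starM : forall x y : A, star (x * y) = star y * star x
}.

#[short(type="starAlgType")]
HB.structure Definition StarAlgebra (C : numClosedFieldType) :=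
  {A of GRing.Algebra C A & isStarAlgebra C A}.

HB.mixin Record isZGraded (C : numClosedFieldType) A & StarAlgebra C A := {
  gr : int -> {pred A};
  gr_submod : forall n, submod_closed (gr n);
  gr1 : 1 \in gr 0;
  grM : forall m n x y, x \in gr m -> y \in gr n -> x * y \in gr (m + n);
  gr_star : forall n x, x \in gr n -> star x \in gr (- n);
  gr_span : forall x : A, exists (s : seq int) (f : int -> A),
    (forall n, f n \in gr n) /\ x = \sum_(n <- s) f n;
  gr0C : forall x y, x \in gr 0 -> y \in gr 0 -> x * y = y * x;
  gr_direct : forall (s : seq int) (f : int -> A), uniq s ->
    (forall n, f n \in gr n) -> \sum_(n <- s) f n = 0 ->
    forall n, n \in s -> f n = 0
}.

#[short(type="gradedStarAlgType")]
HB.structure Definition GradedStarAlgebra (C : numClosedFieldType) :=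
  {A of StarAlgebra C A & isZGraded C A}.

Arguments gr {C A} n : rename.

Section DegreeZero.
Variables (C : numClosedFieldType) (A : gradedStarAlgType C).

Definition gr0 : {pred A} := gr 0.

Fact gr0_subalg : subalg_closed gr0.
Proof.
have [_ h] := @gr_submod C A 0; split; [exact: gr1|exact: h|].
by move=> x y hx hy; rewrite /gr0 -[0]addr0; apply: grM.
Qed.

HB.instance Definition _ := GRing.isSubalgClosed.Build C A gr0
  (GRing.subalg_closed_semi gr0_subalg).

Record deg0 := Deg0 { deg0_val : A; deg0_in : deg0_val \in gr0 }.
HB.instance Definition _ := [isSub for deg0_val].
HB.instance Definition _ := [Choice of deg0 by <:].
HB.instance Definition _ := [SubChoice_isSubAlgebra of deg0 by <:].

Fact deg0_mulC : @commutative deg0 deg0 *%R.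
Proof. by move=> x y; apply: val_inj; rewrite !rmorphM /= gr0C ?deg0_in. Qed.
HB.instance Definition _ :=
  GRing.PzRing_hasCommutativeMul.Build deg0 deg0_mulC.

(* Only used for x in A_0; elsewhere the value is the junk value 0. *)
Definition to0 (x : A) : deg0 := insubd 0 x.

Lemma to0K (x : A) : x \in gr 0 -> val (to0 x) = x.
Proof. by move=> hx; rewrite /to0 insubdK. Qed.

Lemma gr_conj n (c : A) (b : deg0) : c \in gr n -> star c * val b * c \in gr 0.
Proof.
move=> hc; rewrite -[0](addNr n) -[- n]addr0.
by apply: grM => //; apply: grM (deg0_in b); exact: gr_star.
Qed.

End DegreeZero.

(* C<a, a* | a a* = q a* a + 1> as the quotient of the formal expressions in
   the two generators by the least congruence containing the axioms of unital
   C-algebras and the defining relation. *)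
Inductive qexpr (C : Type) :=
  | Qann | Qcre | Qconst of C | Qadd of qexpr C & qexpr C
  | Qmul of qexpr C & qexpr C.
Arguments Qann {C}.
Arguments Qcre {C}.

HB.instance Definition _ (C : Type) := gen_eqMixin (qexpr C).
HB.instance Definition _ (C : Type) := gen_choiceMixin (qexpr C).

Section QOscillator.
Variables (R : realType) (q : R).
Local Notation C := R[i].
Local Notation qexpr := (qexpr C).
Local Notation qC := (q%:C)%C.

Inductive qcong : qexpr -> qexpr -> Prop :=
  | Qrefl x : qcong x x
  | Qsym x y of qcong x y : qcong y x
  | Qtrans x y z of qcong x y & qcong y z : qcong x z
  | QcongD x x' y y' of qcong x x' & qcong y y' :
      qcong (Qadd x y) (Qadd x' y')
  | QcongM x x' y y' of qcong x x' & qcong y y' :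
      qcong (Qmul x y) (Qmul x' y')
  | QaddA x y z : qcong (Qadd x (Qadd y z)) (Qadd (Qadd x y) z)
  | QaddC x y : qcong (Qadd x y) (Qadd y x)
  | Qadd0 x : qcong (Qadd (Qconst 0) x) x
  | QaddN x : qcong (Qadd (Qmul (Qconst (-1)) x) x) (Qconst 0)
  | QmulA x y z : qcong (Qmul x (Qmul y z)) (Qmul (Qmul x y) z)
  | Qmul1 x : qcong (Qmul (Qconst 1) x) x
  | QmulDl x y z : qcong (Qmul (Qadd x y) z) (Qadd (Qmul x z) (Qmul y z))
  | QmulDr x y z : qcong (Qmul x (Qadd y z)) (Qadd (Qmul x y) (Qmul x z))
  | QconstD s t : qcong (Qconst (s + t)) (Qadd (Qconst s) (Qconst t))
  | QconstM s t : qcong (Qconst (s * t)) (Qmul (Qconst s) (Qconst t))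
  | QconstC s x : qcong (Qmul (Qconst s) x) (Qmul x (Qconst s))
  | Qrel : qcong (Qmul Qann Qcre)
             (Qadd (Qmul (Qconst qC) (Qmul Qcre Qann)) (Qconst 1)).

Definition qcongb (x y : qexpr) : bool := `[< qcong x y >].

Fact qcongb_refl : reflexive qcongb.
Proof. by move=> x; apply/asboolP; constructor. Qed.
Fact qcongb_sym : symmetric qcongb.
Proof.
by move=> x y; apply/idP/idP => /asboolP h; apply/asboolP; apply: Qsym.
Qed.
Fact qcongb_trans : transitive qcongb.
Proof.
by move=> y x z /asboolP h /asboolP k; apply/asboolP; apply: Qtrans h k.
Qed.

Canonical qcongb_equiv := EquivRel qcongb qcongb_refl qcongb_sym qcongb_trans.

Definition qosc := {eq_quot qcongb}.
HB.instance Definition _ : EqQuotient _ qcongb qosc := EqQuotient.on qosc.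
HB.instance Definition _ := Choice.on qosc.

Local Notation "\[ x ]" := (\pi_qosc x).

Lemma qoscP (x y : qexpr) : qcong x y <-> \[x] = \[y].
Proof.
split; first by move=> h; apply/eqmodP/asboolP.
by move/eqmodP/asboolP.
Qed.

Lemma qosc_ind (P : qosc -> Prop) : (forall x, P \[x]) -> forall x, P x.
Proof. by move=> h x; rewrite -[x]reprK. Qed.

Definition qadd (x y : qosc) : qosc := \[Qadd (repr x) (repr y)].
Definition qmul (x y : qosc) : qosc := \[Qmul (repr x) (repr y)].
Definition qscale (s : C) (x : qosc) : qosc := \[Qmul (Qconst s) (repr x)].

Lemma qrepr x : qcong (repr \[x]) x.
Proof. by apply/qoscP; rewrite reprK. Qed.

Lemma qaddE x y : qadd \[x] \[y] = \[Qadd x y].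
Proof. by apply/qoscP; apply: QcongD; exact: qrepr. Qed.
Lemma qmulE x y : qmul \[x] \[y] = \[Qmul x y].
Proof. by apply/qoscP; apply: QcongM; exact: qrepr. Qed.
Lemma qscaleE s x : qscale s \[x] = \[Qmul (Qconst s) x].
Proof. by apply/qoscP; apply: QcongM; [constructor|exact: qrepr]. Qed.

Fact qaddA : associative qadd.
Proof.
by elim/qosc_ind=> x; elim/qosc_ind=> y; elim/qosc_ind=> z;
  rewrite !qaddE; apply/qoscP; constructor.
Qed.
Fact qaddC : commutative qadd.
Proof.
by elim/qosc_ind=> x; elim/qosc_ind=> y; rewrite !qaddE; apply/qoscP;
  constructor.
Qed.
Fact qadd0 : left_id \[Qconst 0] qadd.
Proof. by elim/qosc_ind=> x; rewrite !qaddE; apply/qoscP; constructor. Qed.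
Fact qaddN : left_inverse \[Qconst 0] (qscale (-1)) qadd.
Proof.
by elim/qosc_ind=> x; rewrite qscaleE !qaddE; apply/qoscP; constructor.
Qed.
HB.instance Definition _ := GRing.isZmodule.Build qosc qaddA qaddC qadd0 qaddN.

Fact qmulA : associative qmul.
Proof.
by elim/qosc_ind=> x; elim/qosc_ind=> y; elim/qosc_ind=> z;
  rewrite !qmulE; apply/qoscP; constructor.
Qed.
Fact qmul1 : left_id \[Qconst 1] qmul.
Proof. by elim/qosc_ind=> x; rewrite !qmulE; apply/qoscP; constructor. Qed.
Fact qmulr1 : right_id \[Qconst 1] qmul.
Proof.
elim/qosc_ind=> x; rewrite !qmulE; apply/qoscP.
exact: Qtrans (Qsym (QconstC _ _)) (Qmul1 _).
Qed.
Fact qmulDl : left_distributive qmul qadd.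
Proof.
by elim/qosc_ind=> x; elim/qosc_ind=> y; elim/qosc_ind=> z;
  rewrite !(qmulE, qaddE); apply/qoscP; constructor.
Qed.
Fact qmulDr : right_distributive qmul qadd.
Proof.
by elim/qosc_ind=> x; elim/qosc_ind=> y; elim/qosc_ind=> z;
  rewrite !(qmulE, qaddE); apply/qoscP; constructor.
Qed.

(* the q-deformed annihilation and creation operators on sequences; they only
   serve to show that the relations do not collapse the algebra *)
Fixpoint qwt (n : nat) : C := if n is k.+1 then qC * qwt k + 1 else 0.
Fixpoint qact (x : qexpr) (f : nat -> C) : nat -> C :=
  match x with
  | Qann => fun n => qwt n.+1 * f n.+1
  | Qcre => fun n => if n is k.+1 then f k else 0
  | Qconst s => fun n => s * f n
  | Qadd y z => fun n => qact y f n + qact z f n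
  | Qmul y z => qact y (qact z f)
  end.

Fact qact_lin x (s : C) f g n :
  qact x (fun k => s * f k + g k) n = s * qact x f n + qact x g n.
Proof.
elim: x f g n => [||t|y IHy z IHz|y IHy z IHz] f g n /=.
- by rewrite mulrDr mulrCA.
- by case: n => [|n] //; rewrite mulr0 addr0.
- by rewrite mulrDr mulrCA.
- by rewrite IHy IHz mulrDr addrACA.
- rewrite -IHy; congr (qact y _ n); apply: funext => k; exact: IHz.
Qed.

Fact qact0 x n : qact x (fun=> 0) n = 0.
Proof.
elim: x n => [||t|y IHy z IHz|y IHy z IHz] n /=; rewrite ?mulr0 //.
- by case: n.
- by rewrite IHy IHz addr0.
- by rewrite (funext IHz).
Qed.

Fact qact_cong x y : qcong x y -> qact x = qact y.
Proof.
have ext x' y' : (forall f n, qact x' f n = qact y' f n) -> qact x' = qact y'.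
  by move=> h; apply: funext => f; apply: funext => n.
elim=> {x y} //.
- by move=> x y z _ -> _ ->.
- by move=> x x' y y' _ /= -> _ ->.
- by move=> x x' y y' _ /= -> _ ->.
- by move=> x y z; apply: ext => f n /=; rewrite addrA.
- by move=> x y; apply: ext => f n /=; rewrite addrC.
- by move=> x; apply: ext => f n /=; rewrite mul0r add0r.
- by move=> x; apply: ext => f n /=; rewrite mul0r mulN1r addNr.
- move=> x; apply: ext => f n /=; rewrite mul1r //.
- move=> x y z; apply: ext => f n /=.
  rewrite -[RHS]mul1r -[X in _ = 1 * X]mul1r.
  have -> : (fun k => qact y f k + qact z f k) =
            (fun k => 1 * qact y f k + qact z f k).
    by apply: funext => k; rewrite mul1r.
  by rewrite qact_lin !mul1r.
- by move=> s t; apply: ext => f n /=; rewrite mulrDl.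
- by move=> s t; apply: ext => f n /=; rewrite mulrA.
- move=> s x; apply: ext => f n /=.
  have -> : (fun k => s * f k) = (fun k => s * f k + (fun=> 0) k).
    by apply: funext => k; rewrite addr0.
  rewrite qact_lin -[LHS]addr0; congr (_ + _).
  exact/esym/qact0.
- apply: ext => f [|n] /=.
    by rewrite !mulr0 !add0r.
  by rewrite mulrDl -mulrA.
Qed.

Fact qosc1_neq0 : \[Qconst 1] != \[Qconst 0].
Proof.
apply/eqP => /qoscP /qact_cong /(congr1 (fun T => T (fun=> 1) 0%N)) /=.
by rewrite mul1r mul0r; apply/eqP; exact: oner_neq0.
Qed.

HB.instance Definition _ := GRing.Zmodule_isNzRing.Build qosc
  qmulA qmul1 qmulr1 qmulDl qmulDr qosc1_neq0.

Fact qscaleA s t x : qscale s (qscale t x) = qscale (s * t) x.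
Proof.
elim/qosc_ind: x => x; rewrite !qscaleE; apply/qoscP.
by apply: Qtrans (QmulA _ _ _) _; apply: QcongM; constructor; constructor.
Qed.
Fact qscale1 : left_id 1 qscale.
Proof. by elim/qosc_ind=> x; rewrite qscaleE; apply/qoscP; constructor. Qed.
Fact qscaleDr : right_distributive qscale +%R.
Proof.
move=> s; elim/qosc_ind=> x; elim/qosc_ind=> y.
by rewrite /GRing.add/= !(qaddE, qscaleE); apply/qoscP; constructor.
Qed.
Fact qscaleDl x : {morph qscale^~ x : s t / s + t}.
Proof.
move=> s t; elim/qosc_ind: x => x.
rewrite [RHS]/GRing.add/= !(qaddE, qscaleE); apply/qoscP.
by apply: Qtrans (QmulDl _ _ _); apply: QcongM; constructor.
Qed.
HB.instance Definition _ := GRing.Zmodule_isLmodule.Build C qosc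
  qscaleA qscale1 qscaleDr qscaleDl.

Fact qscaleAl s (x y : qosc) : s *: (x * y) = s *: x * y.
Proof.
rewrite /GRing.scale/= /GRing.mul/=; elim/qosc_ind: x => x.
by elim/qosc_ind: y => y; rewrite !(qmulE, qscaleE); apply/qoscP; constructor.
Qed.
HB.instance Definition _ := GRing.Lmodule_isLalgebra.Build C qosc qscaleAl.
Fact qscaleAr s (x y : qosc) : s *: (x * y) = x * (s *: y).
Proof.
rewrite /GRing.scale/= /GRing.mul/=; elim/qosc_ind: x => x.
elim/qosc_ind: y => y; rewrite !(qmulE, qscaleE); apply/qoscP.
apply: Qtrans (QmulA _ _ _) _; apply: Qtrans (Qsym (QmulA _ _ _)).
exact: QcongM (QconstC _ _) (Qrefl _).
Qed.
HB.instance Definition _ := GRing.Lalgebra_isAlgebra.Build C qosc qscaleAr.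

Definition ann : qosc := \[Qann].
Definition cre : qosc := \[Qcre].

Lemma qoscD x y : \[Qadd x y] = \[x] + \[y].
Proof. by rewrite [RHS]/GRing.add/= qaddE. Qed.
Lemma qoscM x y : \[Qmul x y] = \[x] * \[y].
Proof. by rewrite [RHS]/GRing.mul/= qmulE. Qed.
Lemma qoscC s : \[Qconst s] = s%:A.
Proof.
rewrite /GRing.scale/= /GRing.one/= qscaleE; apply/qoscP.
by apply: Qsym; apply: Qtrans (QconstC _ _) _; constructor.
Qed.

Lemma qosc_relation : ann * cre = qC *: (cre * ann) + 1.
Proof.
rewrite -qoscM; have /qoscP -> := Qrel.
by rewrite qoscD !qoscM !qoscC mulr_algl scale1r.
Qed.

Section Lift.
Variables (D : algType C) (u v : D).
Hypothesis uv : u * v = qC *: (v * u) + 1.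

Fixpoint qeval (x : qexpr) : D :=
  match x with
  | Qann => u
  | Qcre => v
  | Qconst s => s%:A
  | Qadd y z => qeval y + qeval z
  | Qmul y z => qeval y * qeval z
  end.

Fact qeval_cong x y : qcong x y -> qeval x = qeval y.
Proof.
elim=> {x y} //=.
- by move=> x y z _ -> _ ->.
- by move=> x x' y y' _ -> _ ->.
- by move=> x x' y y' _ -> _ ->.
- by move=> x y z; rewrite addrA.
- by move=> x y; rewrite addrC.
- by move=> x; rewrite scale0r add0r.
- by move=> x; rewrite mulr_algl scale0r scaleN1r addNr.
- by move=> x y z; rewrite mulrA.
- by move=> x; rewrite scale1r mul1r.
- by move=> x y z; rewrite mulrDl.
- by move=> x y z; rewrite mulrDr.
- by move=> s t; rewrite scalerDl.
- by move=> s t; rewrite mulr_algl scalerA.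
- by move=> s x; rewrite mulr_algl mulr_algr.
- by rewrite mulr_algl scale1r.
Qed.

Definition qlift (x : qosc) : D := qeval (repr x).

Lemma qliftE x : qlift \[x] = qeval x.
Proof. by apply: qeval_cong; exact: qrepr. Qed.
Lemma qlift_ann : qlift ann = u.
Proof. exact: qliftE. Qed.
Lemma qlift_cre : qlift cre = v.
Proof. exact: qliftE. Qed.
Lemma qlift1 : qlift 1 = 1.
Proof. by rewrite /GRing.one/= qliftE /= scale1r. Qed.
Lemma qliftD : {morph qlift : x y / x + y}.
Proof.
by elim/qosc_ind=> x; elim/qosc_ind=> y; rewrite -qoscD !qliftE.
Qed.
Lemma qliftM : {morph qlift : x y / x * y}.
Proof.
by elim/qosc_ind=> x; elim/qosc_ind=> y; rewrite -qoscM !qliftE.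
Qed.
Lemma qliftZ s x : qlift (s *: x) = s *: qlift x.
Proof.
by rewrite -mulr_algl qliftM -qoscC qliftE /= mulr_algl.
Qed.
End Lift.

Fixpoint qstar (x : qexpr) : qexpr :=
  match x with
  | Qann => Qcre
  | Qcre => Qann
  | Qconst s => Qconst s^*
  | Qadd y z => Qadd (qstar y) (qstar z)
  | Qmul y z => Qmul (qstar z) (qstar y)
  end.

Fact conj_qC : qC^* = qC.
Proof. by apply/CrealP; rewrite complex_real. Qed.

Fact qstar_cong x y : qcong x y -> qcong (qstar x) (qstar y).
Proof.
elim=> {x y} /=; try by constructor.
- by move=> x y z _ h _ k; apply: Qtrans h k.
- by move=> x; rewrite conjC0; constructor.
- move=> x; rewrite conjC0 rmorphN1.
  apply: Qtrans (QaddN (qstar x)); apply: QcongD; last by constructor.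
  by apply: Qsym; constructor.
- by move=> x y z; apply: Qsym; constructor.
- by move=> x; rewrite conjC1; apply: Qtrans (Qsym (QconstC _ _)) _; constructor.
- by move=> s t; rewrite rmorphD; constructor.
- by move=> s t; rewrite rmorphM mulrC; constructor.
- by move=> s x; apply: Qsym; constructor.
- rewrite conj_qC conjC1; apply: Qtrans Qrel _.
  exact: QcongD (QconstC _ _) (Qrefl _).
Qed.

Definition qoscstar (x : qosc) : qosc := \[qstar (repr x)].

Lemma qoscstarE x : qoscstar \[x] = \[qstar x].
Proof. by apply/qoscP; apply: qstar_cong; exact: qrepr. Qed.

Fact qoscstarK : involutive qoscstar.
Proof.
elim/qosc_ind=> x; rewrite !qoscstarE; congr (\[_]).
by elim: x => //= [s|y -> z ->|y -> z ->] //; rewrite conjCK.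
Qed.
Fact qoscstarD : {morph qoscstar : x y / x + y}.
Proof.
by elim/qosc_ind=> x; elim/qosc_ind=> y; rewrite -qoscD !qoscstarE qoscD.
Qed.
Fact qoscstarM (x y : qosc) : qoscstar (x * y) = qoscstar y * qoscstar x.
Proof.
elim/qosc_ind: x => x; elim/qosc_ind: y => y.
by rewrite -qoscM !qoscstarE qoscM.
Qed.
Fact qoscstarZ s (x : qosc) : qoscstar (s *: x) = s^* *: qoscstar x.
Proof.
by rewrite -mulr_algl qoscstarM -qoscC qoscstarE /= qoscC mulr_algr.
Qed.

HB.instance Definition _ := isStarAlgebra.Build C qosc
  qoscstarK qoscstarD qoscstarZ qoscstarM.

Lemma star_ann : star ann = cre.
Proof. exact: qoscstarE. Qed.

(* the least family of subspaces, stable under products, with a in degree 1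
   and a* in degree -1 *)
Inductive qgr : int -> qosc -> Prop :=
  | Qgr_ann : qgr 1 ann
  | Qgr_cre : qgr (-1) cre
  | Qgr_one : qgr 0 1
  | Qgr_zero n : qgr n 0
  | Qgr_lin n (s : C) x y of qgr n x & qgr n y : qgr n (s *: x + y)
  | Qgr_mul m n x y of qgr m x & qgr n y : qgr (m + n) (x * y).

Definition qdeg (n : int) : {pred qosc} := [pred x | `[< qgr n x >]].

Lemma qdegP n x : reflect (qgr n x) (x \in qdeg n).
Proof. exact: asboolP. Qed.

Fact qdeg_submod n : submod_closed (qdeg n).
Proof.
split; first by apply/qdegP; constructor.
by move=> s x y /qdegP hx /qdegP hy; apply/qdegP; constructor.
Qed.
Fact qdeg1 : 1 \in qdeg 0.
Proof. by apply/qdegP; constructor. Qed.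
Fact qdegM m n x y : x \in qdeg m -> y \in qdeg n -> x * y \in qdeg (m + n).
Proof. by move=> /qdegP hx /qdegP hy; apply/qdegP; constructor. Qed.
Fact qdeg_star n x : x \in qdeg n -> star x \in qdeg (- n).
Proof.
move=> /qdegP hx; apply/qdegP; elim: hx => {n x}.
- by rewrite star_ann; constructor.
- by rewrite -star_ann starK opprK; constructor.
- rewrite oppr0; have -> : star (1 : qosc) = 1; last by constructor.
  by have := starM (star 1) (1 : qosc); rewrite mulr1 starK mulr1.
- move=> n; have -> : star (0 : qosc) = 0; last by constructor.
  by apply: (@addrI _ (star 0)); rewrite -starD !addr0.
- by move=> n s x y _ hx _ hy; rewrite starD starZ; constructor.
- by move=> m n x y _ hx _ hy; rewrite starM opprD addrC; constructor.
Qed.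

Definition qspan (x : qosc) := exists (s : seq int) (f : int -> qosc),
  (forall n, f n \in qdeg n) /\ x = \sum_(n <- s) f n.

Fact qspan_seq (r : seq (int * qosc)) :
  (forall p, p \in r -> p.2 \in qdeg p.1) -> qspan (\sum_(p <- r) p.2).
Proof.
move=> hr; exists (undup (map fst r)).
exists (fun n => \sum_(p <- r | p.1 == n) p.2); split.
  move=> n; rewrite big_seq_cond; apply: (big_ind (fun x => x \in qdeg n)).
  - by apply/qdegP; constructor.
  - by move=> x y /qdegP hx /qdegP hy; apply/qdegP; rewrite -[x]scale1r;
      constructor.
  - by move=> p /andP[/hr + /eqP <-].
rewrite [RHS](exchange_big_dep xpredT) //=; rewrite [LHS]big_seq [RHS]big_seq.
apply: eq_bigr => p pr; rewrite -big_filter.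
rewrite (_ : seq.filter _ _ = [:: p.1]) ?big_seq1 //.
under eq_filter do rewrite eq_sym.
by rewrite filter_pred1_uniq ?undup_uniq // mem_undup map_f.
Qed.

Definition qhoms (x : qosc) := exists2 r : seq (int * qosc),
  (forall p, p \in r -> p.2 \in qdeg p.1) & x = \sum_(p <- r) p.2.

Fact qhoms1 n x : x \in qdeg n -> qhoms x.
Proof.
move=> h; exists [:: (n, x)]; last by rewrite big_seq1.
by move=> p; rewrite inE => /eqP->.
Qed.

Fact qdeg_span (x : qosc) : qspan x.
Proof.
suff [r hr ->] : qhoms x by exact: qspan_seq.
elim/qosc_ind: x => x; elim: x => [||s|y [r hr hy] z [t ht hz]|].
- by apply: (@qhoms1 1); apply/qdegP; constructor.
- by apply: (@qhoms1 (-1)); apply/qdegP; constructor.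
- apply: (@qhoms1 0); rewrite qoscC -[s%:A]addr0; apply/qdegP.
  by do 2?constructor.
- exists (r ++ t); last by rewrite big_cat/= qoscD hy hz.
  by move=> p; rewrite mem_cat => /orP[/hr|/ht].
move=> y [r hr hy] z [t ht hz].
exists [seq (p.1 + p'.1, p.2 * p'.2) | p <- r, p' <- t].
  by move=> _ /allpairsP[[p p'] /= [/hr + /ht + ->]]; exact: qdegM.
rewrite qoscM hy hz mulr_suml big_allpairs_dep; apply: eq_bigr => p _.
by rewrite mulr_sumr.
Qed.

(* the automorphism a |-> 2 a, a* |-> a* / 2, which separates the degrees *)
Fact qtwist_rel :
  (2 *: ann) * (2^-1 *: cre) = qC *: ((2^-1 *: cre) * (2 *: ann)) + 1.
Proof.
have two0 : (2 : C) != 0 by rewrite pnatr_eq0.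
have h (x y : qosc) : (2 *: x) * (2^-1 *: y) = x * y.
  by rewrite -scalerAl -scalerAr scalerA mulfV // scale1r.
have k (x y : qosc) : (2^-1 *: x) * (2 *: y) = x * y.
  by rewrite -scalerAl -scalerAr scalerA mulVf // scale1r.
by rewrite h k qosc_relation.
Qed.
Definition qtwist := qlift (2 *: ann) (2^-1 *: cre).

Fact qtwistZ n x : x \in qdeg n -> qtwist x = (2 : C) ^ n *: x.
Proof.
move=> /qdegP; elim=> {n x}.
- by rewrite /qtwist (qlift_ann qtwist_rel) expr1z.
- by rewrite /qtwist (qlift_cre qtwist_rel) exprN1.
- by rewrite /qtwist (qlift1 qtwist_rel) expr0z scale1r.
- move=> n; rewrite scaler0; have := qliftZ qtwist_rel 0 0.
  by rewrite !scale0r.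
- move=> n s x y _ hx _ hy.
  have -> : qtwist (s *: x + y) = s *: qtwist x + qtwist y.
    by rewrite -(qliftZ qtwist_rel) -(qliftD qtwist_rel).
  by rewrite hx hy scalerDr !scalerA mulrC.
- move=> m n x y _ hx _ hy.
  have -> : qtwist (x * y) = qtwist x * qtwist y by exact: (qliftM qtwist_rel).
  by rewrite hx hy -scalerAl -scalerAr scalerA expfzDr ?pnatr_eq0.
Qed.

Fact qtwist_sum (s : seq int) (f : int -> qosc) :
  qtwist (\sum_(n <- s) f n) = \sum_(n <- s) qtwist (f n).
Proof.
apply: (big_morph qtwist (qliftD qtwist_rel)).
by have := qliftZ qtwist_rel 0 0; rewrite !scale0r.
Qed.

Fact pow2_inj (m n : int) : (2 : C) ^ m = 2 ^ n -> m = n.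
Proof.
have -> : (2 : C) = real_complex R 2 by rewrite rmorph_nat.
rewrite -!fmorphXz => /fmorph_inj; apply: ieexprIz; first exact: ltr0n.
by rewrite pnatr_eq1.
Qed.

Fact qdeg_direct (s : seq int) (f : int -> qosc) : uniq s ->
  (forall n, f n \in qdeg n) -> \sum_(n <- s) f n = 0 ->
  forall n, n \in s -> f n = 0.
Proof.
elim: s f => [|m s IHs] f //= /andP[ms us] hf; rewrite big_cons => hs.
have fs n : n \in s -> f n = 0.
  move=> ns; have /IHs : forall n, (2 ^ n - 2 ^ m : C) *: f n \in qdeg n.
    move=> k; apply/qdegP; rewrite -[X in qgr _ X]addr0.
    by constructor; [exact/qdegP/hf|constructor].
  move=> /(_ us); under eq_bigr do rewrite scalerBl -qtwistZ //.
  rewrite sumrB -qtwist_sum -scaler_sumr.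
  have -> : \sum_(n <- s) f n = - f m by apply/eqP; rewrite -addr_eq0 addrC hs.
  have -> : qtwist (- f m) = (2 : C) ^ m *: - f m.
    apply: qtwistZ; rewrite -scaleN1r -[_ *: _]addr0.
    by apply/qdegP; constructor; [exact/qdegP/hf|constructor].
  rewrite subrr => /(_ erefl n ns) /eqP; rewrite scaler_eq0 => /orP[|/eqP//].
  by rewrite subr_eq0 => /eqP/pow2_inj nm; rewrite -nm ns in ms.
move=> n; rewrite inE => /orP[/eqP->|]; last exact: fs.
by rewrite -hs [X in _ + X]big_seq big1 ?addr0.
Qed.

Section NormalOrder.
Variable S : C -> Prop.
Hypotheses (S1 : S 1) (Sq : S qC) (SD : forall s t, S s -> S t -> S (s + t)).
Hypothesis SM : forall s t, S s -> S t -> S (s * t).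

Inductive qnormal : int -> qosc -> Prop :=
  | Qn_zero n : qnormal n 0
  | Qn_lin n (s : C) (i j : nat) x of S s & j%:Z - i%:Z = n & qnormal n x :
      qnormal n (s *: (cre ^+ i * ann ^+ j) + x).

Fact qnormalD n x y : qnormal n x -> qnormal n y -> qnormal n (x + y).
Proof.
by elim=> [{}n|{}n s i j {}x Ss ij _ IH] h; rewrite ?add0r // -addrA;
  constructor => //; exact: IH.
Qed.

Fact qnormalZ n s x : S s -> qnormal n x -> qnormal n (s *: x).
Proof.
move=> Ss; elim=> [{}n|{}n t i j {}x St ij _ IH]; rewrite ?scaler0;
  first by constructor.
by rewrite scalerDr scalerA; constructor => //; exact: SM.
Qed.

Fact qnormal_mono i j : qnormal (j%:Z - i%:Z) (cre ^+ i * ann ^+ j).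
Proof.
by rewrite -[_ * _]addr0 -[cre ^+ i * _]scale1r; constructor; last constructor.
Qed.

Fact Sqwt n : S (qwt n.+1).
Proof.
elim: n => [|n IHn] /=; first by rewrite mulr0 add0r.
by apply: SD => //; apply: SM.
Qed.

Fact SqX n : S (qC ^+ n).
Proof. by elim: n => [|n IHn]; rewrite ?expr0 // exprS; apply: SM. Qed.

Fact ann_creX n :
  ann * cre ^+ n = qC ^+ n *: (cre ^+ n * ann) + qwt n *: cre ^+ n.-1.
Proof.
elim: n => [|n IHn]; first by rewrite !expr0 mulr1 mul1r scale1r scale0r addr0.
have -> : ann * cre ^+ n.+1 = qC *: (cre * (ann * cre ^+ n)) + cre ^+ n.
  by rewrite exprS mulrA qosc_relation mulrDl mul1r -scalerAl mulrA.
rewrite IHn mulrDr -!scalerAr scalerDr !scalerA mulrA -!exprS -addrA.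
congr (_ + _); rewrite /= scalerDl scale1r; congr (_ + _).
by case: n {IHn} => [|n]; rewrite /= ?mulr0 ?scale0r // exprS.
Qed.

Fact qnormal_ann n x : qnormal n x -> qnormal (1 + n) (ann * x).
Proof.
elim=> [{}n|{}n s i j {}x Ss ij _ IH]; first by rewrite mulr0; constructor.
rewrite mulrDr -scalerAr mulrA ann_creX mulrDl -!scalerAl -mulrA -exprS.
apply: qnormalD IH; apply: qnormalZ => //; apply: qnormalD.
  apply: qnormalZ; first exact: SqX.
  by rewrite -ij addrA -intS; exact: qnormal_mono.
case: i ij => [|i] ij; first by rewrite scale0r; constructor.
apply: qnormalZ; first exact: Sqwt.
rewrite (_ : 1 + n = j%:Z - i%:Z); first exact: qnormal_mono.
by rewrite -ij intS opprD addrCA addNKr.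
Qed.

Fact qnormal_cre n x : qnormal n x -> qnormal (-1 + n) (cre * x).
Proof.
elim=> [{}n|{}n s i j {}x Ss ij _ IH]; first by rewrite mulr0; constructor.
rewrite mulrDr -scalerAr mulrA -exprS; apply: qnormalD IH.
apply: qnormalZ => //; rewrite -ij addrCA -opprD -intS; exact: qnormal_mono.
Qed.

Fact qnormalM m n x y : qnormal m x -> qnormal n y -> qnormal (m + n) (x * y).
Proof.
move=> + hy; elim=> [{}m|{}m s i j {}x Ss ij _ IH].
  by rewrite mul0r; constructor.
rewrite mulrDl -scalerAl; apply: qnormalD IH; apply: qnormalZ => //.
move: ij => <-; rewrite -mulrA [j%:Z - _]addrC -addrA.
elim: i => [|i IHi]; last by rewrite exprS -mulrA intS opprD -addrA;
  exact: qnormal_cre.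
rewrite expr0 mul1r oppr0 add0r.
elim: j => [|j IHj]; first by rewrite expr0 mul1r add0r.
by rewrite exprS -mulrA intS -addrA; exact: qnormal_ann.
Qed.

End NormalOrder.

Fact starX (x : qosc) n : star (x ^+ n) = star x ^+ n.
Proof.
elim: n => [|n IHn]; last by rewrite exprS starM IHn exprSr.
by rewrite !expr0; have := starM (star 1) (1 : qosc); rewrite mulr1 starK mulr1.
Qed.

Fact qnormal_real n x :
  qnormal (fun s => s^* = s) n x -> n = 0 -> star x = x.
Proof.
elim=> {n x}.
  by move=> n _; apply: (@addrI _ (star 0)); rewrite -starD !addr0.
move=> n s i j x Ss ij _ IH n0; rewrite starD starZ Ss starM !starX star_ann.
rewrite IH // -star_ann starK star_ann; congr (_ *: (_ ^+ _ * _ ^+ _) + _).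
all: by apply/eqP; move: ij; rewrite n0 => /eqP; rewrite subr_eq0 eqz_nat // eq_sym.
Qed.

Fact qgr_normal n x : qgr n x -> qnormal (fun=> True) n x.
Proof.
elim=> {n x}.
- by have := @qnormal_mono (fun=> True) I 0 1; rewrite expr0 mul1r.
- by have := @qnormal_mono (fun=> True) I 1 0; rewrite expr0 mulr1.
- by have := @qnormal_mono (fun=> True) I 0 0; rewrite !expr0 mulr1.
- by move=> n; constructor.
- by move=> n s x y _ hx _ hy; apply: qnormalD hy; apply: qnormalZ.
- by move=> m n x y _ hx _ hy; apply: qnormalM.
Qed.

Fact qnormal_comm (z : qosc) n x :
  (forall i, GRing.comm z (cre ^+ i * ann ^+ i)) ->
  qnormal (fun=> True) n x -> n = 0 -> GRing.comm z x.
Proof.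
move=> hz; elim=> {n x}; first by move=> n _; exact: commr0.
move=> n s i j x _ ij _ IH n0; apply: commrD; last exact: IH.
have -> : i = j.
  by apply/eqP; rewrite -eqz_nat eq_sym -subr_eq0 ij n0.
by rewrite /GRing.comm -scalerAl -scalerAr hz.
Qed.

Fact qdeg0C (x y : qosc) : x \in qdeg 0 -> y \in qdeg 0 -> x * y = y * x.
Proof.
move=> /qdegP/qgr_normal hx /qdegP/qgr_normal hy.
have mono i : star (cre ^+ i * ann ^+ i) = cre ^+ i * ann ^+ i.
  by rewrite starM !starX star_ann -star_ann starK.
have real i : qnormal (fun s => s^* = s) 0 (cre ^+ i * ann ^+ i).
  by have := @qnormal_mono (fun s => s^* = s) (conjC1 _) i i; rewrite subrr.
apply: (qnormal_comm _ hy erefl) => i; apply/commr_sym.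
apply: (qnormal_comm _ hx erefl) => j; rewrite /GRing.comm.
rewrite -[LHS](@qnormal_real 0) //; first by rewrite starM !mono.
rewrite -[0]addr0.
apply: qnormalM => //; [exact: conjC1|exact: conj_qC|..].
  by move=> s t hs ht; rewrite rmorphD; congr (_ + _).
by move=> s t hs ht; rewrite rmorphM; congr (_ * _).
Qed.

HB.instance Definition _ := isZGraded.Build C qosc
  qdeg_submod qdeg1 qdegM qdeg_star qdeg_span qdeg0C qdeg_direct.

End QOscillator.

Section Characters.
Variables (R : realType) (A : gradedStarAlgType R[i]).
Local Notation C := R[i].
Local Notation B := (deg0 A).

(* Characters live in the space of all functions B -> C; the topology of
   pointwise convergence induces on them the weak topology given by the
   evaluations at b : B. *)
Definition functional := {ptws B -> C^o}.

Definition characters : set functional := [set chi |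
  [/\ forall (z : C) (x y : B), chi (z *: x + y) = z * chi x + chi y,
      forall x y : B, chi (x * y) = chi x * chi y,
      forall x : B, chi (to0 (star (val x))) = (chi x)^* &
      exists x : B, chi x != 0]].

Definition positive_characters : set functional := [set chi |
  characters chi /\
  forall n (c : A), c \in gr n -> 0 <= chi (to0 (star c * c)) :> C].

(* [supp_char n] is the domain D_{-n} of alpha_n. *)
Definition supp_char (n : int) : set functional := [set chi |
  positive_characters chi /\
  exists2 c : A, c \in gr n & chi (to0 (star c * c)) != 0].

(* For positive characters in [supp_char n] the value does not depend on the
   choice of c. *)
Definition alpha (n : int) (chi : functional) : functional := fun b =>
  let c := xget 0 [set c : A | c \in gr n /\ chi (to0 (star c * c)) != 0] in
  chi (to0 (star c * val b * c)) / chi (to0 (star c * c)).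

Definition borel_functional := g_sigma_algebraType (@open functional).

End Characters.

Record hilbertSpace (C : numClosedFieldType) := HilbertSpace {
  hilbert_sort :> completeNormedModType C;
  inner : {dot hilbert_sort for @Num.conj C};
  inner_norm : forall x, inner x x = `|x| ^+ 2
}.

Section Operators.
Variables (C : numClosedFieldType) (H : hilbertSpace C).
Local Notation "<< x , y >>" := (inner H x y).

(* An operator in H is given by its graph. *)
Definition opdom (T : set (H * H)) : set H := fst @` T.

Definition is_operator (T : set (H * H)) :=
  [/\ T (0, 0),
      forall (z : C) p q, T p -> T q -> T (z *: p + q) &
      forall y, T (0, y) -> y = 0].

Definition adjoint (T : set (H * H)) : set (H * H) :=
  [set p | forall q, T q -> << q.2, p.1 >> = << q.1, p.2 >>].

Definition normal_op (T : set (H * H)) :=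
  [/\ is_operator T, dense (opdom T), closed T &
      (adjoint T \; T)%relation = (T \; adjoint T)%relation].

Definition orth_projection (P : H -> H) :=
  [/\ forall (z : C) x y, P (z *: x + y) = z *: P x + P y,
      forall x, P (P x) = P x &
      forall x y, << P x, y >> = << x, P y >>].

End Operators.

Section SpectralMeasure.
Variables (R : realType) (H : hilbertSpace R[i]).
Variables (d : measure_display) (T : measurableType d) (X : set T).
Local Notation C := R[i].
Local Notation "<< x , y >>" := (inner H x y).

Definition trace_measurable : set (set T) :=
  [set U `&` X | U in measurable].

Definition spectral_measure (E : set T -> H -> H) :=
  [/\ forall U, trace_measurable U -> orth_projection (E U),
      forall x, E X x = x &
      forall F : nat -> set T, (forall k, trace_measurable (F k)) ->
        trivIset setT F -> forall x,
        series (fun k => E (F k) x) @ \oo --> E (\bigcup_k F k) x].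

Variable E : set T -> H -> H.

(* the scalar measure U |-> <E(U)x, x>, pushed forward from X to T *)
Definition scalar_measure (x : H) : set T -> \bar R :=
  fun U => (complex.Re << E (U `&` X) x, x >>)%:E.

Definition cintegral (mu : set T -> \bar R) (f : T -> C) : C :=
  Complex (fine (\int[mu]_t (complex.Re (f t))%:E)%E)
          (fine (\int[mu]_t (complex.Im (f t))%:E)%E).

Definition spectral_dom (f : T -> C) : set H := [set x |
  (\int[scalar_measure x]_t
     (complex.Re (f t) ^+ 2 + complex.Im (f t) ^+ 2)%:E < +oo)%E].

(* the integral of f against the complex measure U |-> <E(U)x, y>, obtained
   by polarization *)
Definition sesqui_integral (f : T -> C) (x y : H) : C :=
  4^-1 * \sum_(k < 4) 'i ^+ k *
    cintegral (scalar_measure (x + 'i ^+ k *: y)) f.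

(* The graph of the normal operator given by the integral of f.  The value at
   x in the domain is determined by its inner products with the elements of
   the domain, which is dense. *)
Definition spectral_integral (f : T -> C) : set (H * H) := [set p |
  spectral_dom f p.1 /\
  forall y, spectral_dom f y -> << p.2, y >> = sesqui_integral f p.1 y].

End SpectralMeasure.

(* The operators pi(x) : D(pi) -> D(pi) are given by total functions H -> H,
   whose values outside D(pi) are irrelevant. *)
Record starRep (C : numClosedFieldType) (A : starAlgType C)
    (H : hilbertSpace C) := StarRep {
  rep_dom : set H;
  rep : A -> H -> H;
  rep_dom0 : rep_dom 0;
  rep_domP : forall (z : C) u v,
    rep_dom u -> rep_dom v -> rep_dom (z *: u + v);
  rep_dense : dense rep_dom;
  rep_stable : forall x u, rep_dom u -> rep_dom (rep x u);
  rep_linear : forall x (z : C) u v, rep_dom u -> rep_dom v ->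
    rep x (z *: u + v) = z *: rep x u + rep x v;
  repP : forall (z : C) x y u, rep_dom u ->
    rep (z *: x + y) u = z *: rep x u + rep y u;
  repM : forall x y u, rep_dom u -> rep (x * y) u = rep x (rep y u);
  rep_star : forall x u v, rep_dom u -> rep_dom v ->
    inner H (rep x u) v = inner H u (rep (star x) v)
}.

Section Representations.
Variables (C : numClosedFieldType) (A : starAlgType C) (H : hilbertSpace C).
Variable pi : starRep A H.
Local Notation D := (rep_dom pi).

Definition graph_norm (x : A) (u : H) : C := `|u| + `|rep pi x u|.

(* basic neighbourhoods of u in the graph topology of D(pi) *)
Definition graph_ball (xs : seq A) (e : C) (u : H) : set H :=
  [set v | D v /\ forall x, x \in xs -> graph_norm x (u - v) < e].

Definition graph_cauchy (F : set_system H) :=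
  forall (xs : seq A) (e : C), 0 < e ->
    exists2 S, F S & forall u v, S u -> S v -> graph_ball xs e u v.

Definition graph_cvg (F : set_system H) (u : H) :=
  forall (xs : seq A) (e : C), 0 < e -> F (graph_ball xs e u).

Definition closed_rep := forall F : set_system H,
  ProperFilter F -> F D -> graph_cauchy F -> exists2 u, D u & graph_cvg F u.

Definition is_subspace (V : set H) :=
  V 0 /\ forall (z : C) u v, V u -> V v -> V (z *: u + v).

Definition rep_span : set H :=
  smallest is_subspace [set v | exists x, exists2 u, D u & v = rep pi x u].

Definition nondegenerate_rep := forall u, D u ->
  forall (xs : seq A) (e : C), 0 < e -> rep_span `&` graph_ball xs e u !=set0.

Definition rep_graph (x : A) : set (H * H) := [set (u, rep pi x u) | u in D].

End Representations.

Definition extends (C : numClosedFieldType) (A : starAlgType C)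
    (H K : hilbertSpace C) (J : {linear H -> K})
    (rho : starRep A K) (pi : starRep A H) :=
  [/\ forall u v, inner K (J u) (J v) = inner H u v,
      forall u, rep_dom pi u -> rep_dom rho (J u) &
      forall x u, rep_dom pi u -> rep rho x (J u) = J (rep pi x u)].

Section WellBehaved.
Variables (R : realType) (A : gradedStarAlgType R[i]) (H : hilbertSpace R[i]).
Variable pi : starRep A H.
Local Notation Bplus := (@positive_characters R A : set (borel_functional A)).

Definition integrable_rep := forall b : deg0 A,
  normal_op (closure (rep_graph pi (val b))).

Definition well_behaved := [/\ closed_rep pi, integrable_rep &
  exists E : set (borel_functional A) -> H -> H,
  [/\ spectral_measure Bplus E,
      forall b : deg0 A,
        closure (rep_graph pi (val b)) =
          spectral_integral Bplus E (fun chi => chi b) &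
      forall (n : int) (c : A) (U : set (borel_functional A)), c \in gr n ->
        trace_measurable Bplus U -> forall u, rep_dom pi u ->
        rep_dom pi (E U u) /\
        rep pi c (E U u) = E (alpha n @` (U `&` supp_char n)) (rep pi c u)]].

End WellBehaved.

(* Main.v *)
(* An integrable extension restricted to A_0 is given by a positive measure on
   the spectrum, so a well-behaved representation makes <pi(b)u, u> >= 0 for
   every b in A_0 that is nonnegative on positive characters, and this passes to
   the representations it extends.  With N = a^* a, the identity
   q^3 a^*^3 a^3 = N(N - 1)(N - 1 - q) and its analogues for a and a^2 show that
   b = (N - 1)(N - 1 - q) is such an element.  It therefore suffices to find a
   representation with a vector e such that <pi(b)e, e> < 0.

   Orthonormalizing the vectors a^*^k a^j e leads to the ansatz
     a e_{k,j} = al_{k,j} e_{k,j+1} + be_{k,j} e_{k-1,j}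
   on l^2(N x N), and a a^* = q a^* a + 1 becomes, for A = al^2 and B = be^2,
     A_{k,j-1} + B_{k+1,j} = q(A_{k,j} + B_{k,j}) + 1,
     B_{k+1,j} A_{k+1,j} = q^2 A_{k,j} B_{k+1,j+1}.
   Antidiagonal by antidiagonal these equations determine everything from the
   free parameter A_{0,m}, in increasing affine fashion, so that all weights are
   positive when A_{0,m} is large.  Since
     <pi(b)e, e> = (A_{0,0} - 1)(A_{0,0} - 1 - q) + A_{0,0} B_{1,1},
   taking A_{0,0} = 1 + q/2 and B_{1,1} small makes it negative. *)
Require Import Defs.
From HB Require Import structures.
From mathcomp Require Import all_boot all_order all_algebra.
From mathcomp Require Import sesquilinear generic_quotient.
From mathcomp Require Import all_classical all_reals all_analysis.
From mathcomp Require Import complex.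
From mathcomp Require Import ring lra zify.

Set Implicit Arguments.
Unset Strict Implicit.
Unset Printing Implicit Defensive.

Import Order.TTheory GRing.Theory Num.Theory.
Import numFieldNormedType.Exports.

Local Open Scope classical_set_scope.
Local Open Scope ring_scope.
Local Open Scope quotient_scope.

(** * The weights *)

Section Weights.
Variables (R : realType) (q : R).
Hypothesis q0 : 0 < q.

(** A shift with boundary value 0: it encodes A_{k,-1} = 0 and B_{0,j} = 0, so that the relations
    keep one form on the boundary. *)
Definition before (f : nat -> R) (k : nat) : R := if k is i.+1 then f i else 0.

(* A pair S stands for the antidiagonal k + j = m: S.1 k is A_{k,m-k}, equal to
   0 for k > m, and S.2 k is B_{k+1,m-k}. *)
Definition diag_sub (S : (nat -> R) * (nat -> R)) (x : R) (k : nat) : R :=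
  q * (x + before S.2 k) + 1 - S.1 k.

(** The entry A_{k,m+1-k} of the next antidiagonal: for k = i + 1 and j = m - i, the equation
    B_{k,j} A_{k,j} = q^2 A_{i,j} B_{k,j+1} is solved for A_{k,j}, starting from the free parameter
    [x] = A_{0,m+1}. *)
Fixpoint diag_sq (S : (nat -> R) * (nat -> R)) (x : R) (k : nat) : R :=
  if k is i.+1
  then q ^+ 2 * S.1 i * diag_sub S (diag_sq S x i) i / S.2 i else x.

Definition diag_next S x : (nat -> R) * (nat -> R) :=
  (diag_sq S x, fun k => diag_sub S (diag_sq S x k) k).

(** The zeros beyond the antidiagonal are the boundary values A_{k,-1} = 0, which the next
    antidiagonal subtracts. *)
Definition diag_pos (m : nat) (S : (nat -> R) * (nat -> R)) :=
  (forall k, (k <= m)%N -> 0 < S.1 k /\ 0 < S.2 k) /\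
  (forall k, (m < k)%N -> S.1 k = 0).

(* All entries of the new antidiagonal are affine functions of x with positive
   slope. *)
Lemma diag_next_large m S k : diag_pos m S -> (k <= m.+1)%N ->
  forall t, exists M, forall x, M <= x ->
    t <= (diag_next S x).1 k /\ t <= (diag_next S x).2 k.
Proof.
move=> [Spos _].
have sub_large j t :
    (forall s, exists M, forall x, M <= x -> s <= diag_sq S x j) ->
    exists M, forall x, M <= x -> t <= diag_sub S (diag_sq S x j) j.
  move=> /(_ ((t - 1 + S.1 j) / q - before S.2 j))[M hM]; exists M => x /hM.
  by rewrite lerBlDr ler_pdivrMr // /diag_sub; lra.
suff sq_large : (k <= m.+1)%N ->
    forall t, exists M, forall x, M <= x -> t <= diag_sq S x k.
  move=> km t; have [M1 h1] := sq_large km t.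
  have [M2 h2] := sub_large k t (sq_large km).
  exists (Num.max M1 M2) => x; rewrite ge_max => /andP[/h1 ? /h2 ?]; split=> //.
elim: k => [_ t|k IH km t]; first by exists t.
have [/= S1 S2] := Spos _ km.
have [M hM] := sub_large k (t * S.2 k / (q ^+ 2 * S.1 k)) (IH (ltnW km)).
exists M => x /hM /=; rewrite ler_pdivrMr ?mulr_gt0 ?exprn_gt0 //.
by rewrite ler_pdivlMr // mulrC [_ * (q ^+ 2 * _)]mulrC.
Qed.

Lemma diag_next_zero m S x k : diag_pos m S -> (m.+1 < k)%N ->
  (diag_next S x).1 k = 0.
Proof.
move=> [_ S0]; case: k => [//|k] mk /=.
by rewrite S0 // mulr0 !mul0r.
Qed.

(** Each of the finitely many entries up to index m + 1 is at least 1 for large [x]; the maximum of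
    the thresholds serves all of them. *)
Lemma diag_next_pos m S :
  diag_pos m S -> exists x, diag_pos m.+1 (diag_next S x).
Proof.
move=> Sm.
suff [M hM] : exists M, forall x, M <= x -> forall k, (k <= m.+1)%N ->
    0 < (diag_next S x).1 k /\ 0 < (diag_next S x).2 k.
  by exists M; split=> k; [exact: hM|exact: diag_next_zero].
suff h n : (n <= m.+2)%N -> exists M, forall x, M <= x -> forall k, (k < n)%N ->
    0 < (diag_next S x).1 k /\ 0 < (diag_next S x).2 k.
  by have [M hM] := h _ (leqnn _); exists M.
elim: n => [_|n IH nm]; first by exists 0.
have [M1 h1] := IH (ltnW nm).
have [M2 h2] := diag_next_large Sm nm 1.
exists (Num.max M1 M2) => x; rewrite ge_max => /andP[/h1 k1 /h2[k2 k3]] k.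
rewrite ltnS leq_eqVlt => /predU1P[->|/k1//].
by split; apply: lt_le_trans ltr01 _.
Qed.

(* The seeds are A_{0,0}, B_{1,1} and A_{0,1}. *)
Definition seed0 : R := 1 + q / 2.
(** [seed0] is the midpoint of the roots 1 and 1 + q of (t - 1)(t - 1 - q), where the value is - q^2
    / 4. This seed gives A_{0,0} B_{1,1} = q^2 / 8, half of what would cancel it. *)
Definition seed_eps : R := q ^+ 2 / (8 * seed0).
(** Solves q A_{0,1} + 1 - A_{0,0} = B_{1,1} for A_{0,1}. *)
Definition seed1 : R := (seed_eps + q / 2) / q.

(** The zero pair plays the antidiagonal -1. The parameter of antidiagonal 1 is prescribed, since
    B_{1,1} has to be small; from antidiagonal 2 on, any parameter that keeps the entries positive
    is taken. *)
Fixpoint diag (m : nat) : (nat -> R) * (nat -> R) :=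
  match m with
  | 0 => diag_next (fun=> 0, fun=> 0) seed0
  | m'.+1 => let S := diag m' in
    diag_next S (if m' is 0 then seed1
                 else xget 0 [set x | diag_pos m (diag_next S x)])
  end.

Lemma seed0_gt0 : 0 < seed0. Proof. by rewrite /seed0; have := q0; lra. Qed.
Lemma seed_eps_gt0 : 0 < seed_eps.
Proof. by rewrite divr_gt0 ?exprn_gt0 ?mulr_gt0 ?seed0_gt0. Qed.

Lemma diag_pos0 : diag_pos 0 (diag 0).
Proof.
have s0p := seed0_gt0; split=> [[|//] _|[|k] // _] /=; last first.
  by rewrite !(mulr0, mul0r).
split=> //; rewrite /diag_sub /= addr0 subr0 ltr_wpDl //.
by rewrite ltW // mulr_gt0.
Qed.

Lemma diag10 : (diag 1).2 0 = seed_eps.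
Proof.
rewrite /= /diag_sub /= addr0 /seed1 mulrC divfK ?gt_eqF // /seed0; lra.
Qed.

(** Antidiagonals 0 and 1 are checked by hand because their seeds are prescribed. Afterwards
    [diag_next_pos] supplies a parameter, so the default 0 of [xget] is never taken. *)
Lemma diag_pos_diag m : diag_pos m (diag m).
Proof.
case: m => [|m]; first exact: diag_pos0.
elim: m => [|m IH]; last exact: (xgetPex 0 (diag_next_pos IH)).
split; last by move=> k; apply: diag_next_zero; exact: diag_pos0.
have [/(_ 0%N isT)[X0 Y0] Z0] := diag_pos0.
have ep := seed_eps_gt0.
have s1p : 0 < seed1 by rewrite divr_gt0 // addr_gt0 // divr_gt0.
have sq1 : 0 < (diag 1).1 1.
  rewrite [X in 0 < X]/= -/(diag 0) -[X in 0 < _ * X / _]/((diag 1).2 0) diag10.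
  apply: divr_gt0; last exact: Y0.
  apply: mulr_gt0; last exact: ep.
  apply: mulr_gt0; last exact: X0.
  exact: exprn_gt0.
case=> [|[|k]] // _; split=> //.
- by rewrite -[X in 0 < X]/((diag 1).2 0) diag10.
- rewrite -[X in 0 < X]/(q * ((diag 1).1 1 + (diag 0).2 0) + 1 - (diag 0).1 1).
  rewrite (Z0 1%N isT) subr0.
  by apply: ltr_wpDl => //; rewrite ltW // mulr_gt0 // addr_gt0.
Qed.

(** The weights are the square roots of A and B; since all factors are nonnegative, the root of the
    equation with q^2 is the one with q. *)
Lemma weights_exist : exists al be : nat -> nat -> R,
  [/\ forall j, be 0%N j = 0,
      forall k j, before (fun i => al k i ^+ 2) j + be k.+1 j ^+ 2 =
        q * (al k j ^+ 2 + be k j ^+ 2) + 1,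
      forall k j, be k.+1 j * al k.+1 j = q * (al k j * be k.+1 j.+1) &
      al 0%N 0%N ^+ 2 = 1 + q / 2 /\
      (1 + q / 2) * be 1%N 1%N ^+ 2 = q ^+ 2 / 8].
Proof.
pose A k j := (diag (k + j)).1 k.
(* The antidiagonal k + j stores A_{k,j} together with B_{k+1,j}, hence the shift in the first index
   of B. *)
pose B k j := before (fun i => (diag (i + j)).2 i) k.
have A0 k j : 0 < A k j.
  by have [/(_ k (leq_addr _ _))[]] := diag_pos_diag (k + j).
have B0 k j : 0 < B k.+1 j.
  by have [/(_ k (leq_addr _ _))[]] := diag_pos_diag (k + j).
have B0' k j : 0 <= B k j by case: k => [|k]; rewrite ?lexx // ltW.
have diagE k j : before (A k) j + B k.+1 j = q * (A k j + B k j) + 1.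
  suff -> : B k.+1 j = q * (A k j + B k j) + 1 - before (A k) j.
    by rewrite addrC subrK.
  have dS m i : (diag m.+1).2 i =
    q * ((diag m.+1).1 i + before (diag m).2 i) + 1 - (diag m).1 i by [].
  case: j => [|j]; rewrite /A /B [LHS]/before.
    case: k => [|k]; rewrite !addn0 // dS; congr (_ - _).
      by rewrite /before addn0.
    (* The subtracted entry has index k + 1 on antidiagonal k: it stands for A_{k+1,-1} and is 0. *)
    by have [_ ->] := diag_pos_diag k.
  rewrite addnS dS; case: k => [|k]; rewrite /before // addnS addSn.
  by [].
have offE k j : B k.+1 j * A k.+1 j = q ^+ 2 * (A k j * B k.+1 j.+1).
  rewrite /A addSn /= -/(A k j) mulrC.
  rewrite -[X in _ / X]/(B k.+1 j) divfK ?gt_eqF // -mulrA; congr (_ * (_ * _)).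
  by rewrite /B /= addnS.
exists (fun k j => Num.sqrt (A k j)), (fun k j => Num.sqrt (B k j)); split.
- by move=> j; rewrite sqrtr0.
- move=> k j; rewrite !sqr_sqrtr // ?ltW //.
  by rewrite -diagE; congr (_ + _); case: j => //= j; rewrite sqr_sqrtr // ltW.
- move=> k j; rewrite -(sqrtrM _ (ltW (B0 k j))) offE sqrtrM ?exprn_ge0 ?ltW //.
  by rewrite sqrtr_sqr gtr0_norm // sqrtrM ?ltW.
- rewrite !sqr_sqrtr ?ltW // -[A _ _]/seed0 -[B _ _]/((diag 1).2 0%N) diag10.
  split=> //.
  by rewrite /seed_eps -/seed0; field; rewrite gt_eqF ?seed0_gt0.
Qed.
End Weights.

(** * Square-summable sequences *)

Section CauchySchwarz.
Variables (C : numClosedFieldType) (U : lmodType C) (form : {dot U for @Num.conj C}).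

(** With u = w + a v and w orthogonal to v, the two sides differ by the product of the squared norms
    of w and v. *)
Lemma dot_CauchySchwarz (u v : U) : `|form u v| ^+ 2 <= form u u * form v v.
Proof.
have [->|v0] := eqVneq v 0; first by rewrite linear0r normr0 expr0n /= linear0r mulr0.
have vv : 0 < form v v by rewrite dnorm_gt0.
pose a := form u v / form v v; pose w := u - a *: v.
have wv : form w v = 0.
  by rewrite linearBl /= linearZl_LR /= divfK ?subrr ?gt_eqF.
have -> : u = w + a *: v by rewrite subrK.
have -> : form (w + a *: v) v = a * form v v.
  by rewrite linearDl /= wv add0r linearZl_LR.
have -> : form (w + a *: v) (w + a *: v) = form w w + `|a| ^+ 2 * form v v.
  by rewrite hnormDd /= ?dnormZ // linearZr_LR /= wv mulr0.
rewrite normrM exprMn (ger0_norm (ltW vv)) mulrDl expr2 mulrA lerDr.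
by rewrite mulr_ge0 // dnorm_ge0.
Qed.

Lemma dot_triangle (u v : U) :
  sqrtC (form (u + v) (u + v)) <= sqrtC (form u u) + sqrtC (form v v).
Proof.
rewrite -ler_sqr ?nnegrE ?addr_ge0 ?sqrtC_ge0 ?dnorm_ge0 //.
rewrite sqrrD !sqrtCK dnormD /= [leRHS]addrAC lerD2l.
have -> : form u v + (form u v)^* = 'Re (form u v) *+ 2.
  by rewrite -mulr_natr ReE divfK ?pnatr_eq0.
rewrite lerMn2r /=; apply: le_trans (leif_Re_Creal _) _.
rewrite -sqrtCM ?nnegrE ?dnorm_ge0 // -[X in X <= _](sqrCK (normr_ge0 _)).
by rewrite ler_sqrtC ?nnegrE ?exprn_ge0 ?mulr_ge0 ?dnorm_ge0 // dot_CauchySchwarz.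
Qed.
End CauchySchwarz.

Section SquareSummable.
Variable R : realType.
Local Notation C := R[i].
Implicit Types (f g : nat -> R) (F G : nat -> C).

Definition sqn (z : C) : R := complex.Re z ^+ 2 + complex.Im z ^+ 2.

Lemma sqn_ge0 z : 0 <= sqn z.
Proof. by rewrite addr_ge0 ?sqr_ge0. Qed.

Lemma sqn_eq0 z : sqn z = 0 -> z = 0.
Proof.
case: z => a b /eqP; rewrite paddr_eq0 ?sqr_ge0 // !sqrf_eq0 /=.
by move=> /andP[/eqP-> /eqP->].
Qed.

Lemma cvg_series_lin f g (a : R) : cvgn (series f) -> cvgn (series g) ->
  cvgn (series (fun n => a * f n + g n)).
Proof. by move=> cf cg; apply: is_cvg_seriesD => //; exact: is_cvg_seriesZ. Qed.

Lemma lim_series_lin f g (a : R) : cvgn (series f) -> cvgn (series g) ->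
  limn (series (fun n => a * f n + g n)) = a * limn (series f) + limn (series g).
Proof.
move=> cf cg; rewrite -[RHS]/(a *: _ + _) -(lim_seriesZ _ cf).
by rewrite -lim_seriesD //; exact: is_cvg_seriesZ.
Qed.

Lemma cvg_series0 : cvgn (series (fun=> 0 : R)).
Proof.
rewrite (_ : series _ = fun=> 0); first exact: is_cvg_cst.
by apply/funext => n; rewrite /series /= big1.
Qed.

Arguments cvg_series_lin {f g} a.
Arguments lim_series_lin {f g} a.

Definition csummable F :=
  cvgn (series (@complex.Re R \o F)) /\ cvgn (series (@complex.Im R \o F)).

Definition csum F : C :=
  Complex (limn (series (@complex.Re R \o F))) (limn (series (@complex.Im R \o F))).

Lemma csum_lin (z : C) F G : csummable F -> csummable G ->
  csum (fun n => z * F n + G n) = z * csum F + csum G.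
Proof.
case: z => a b [rF iF] [rG iG]; apply/eqP; rewrite eq_complex /=; apply/andP.
split; apply/eqP.
- rewrite (_ : _ \o _ = fun n => a * (@complex.Re R \o F) n +
     (- b * (@complex.Im R \o F) n + (@complex.Re R \o G) n)); last first.
    by apply/funext => n /=; case: (F n) (G n) => ? ? [? ?] /=; ring.
  rewrite (lim_series_lin _ rF (cvg_series_lin _ iF rG)) (lim_series_lin _ iF rG).
  by rewrite addrA mulNr.
- rewrite (_ : _ \o _ = fun n => a * (@complex.Im R \o F) n +
     (b * (@complex.Re R \o F) n + (@complex.Im R \o G) n)); last first.
    by apply/funext => n /=; case: (F n) (G n) => ? ? [? ?] /=; ring.
  rewrite (lim_series_lin _ iF (cvg_series_lin _ rF iG)) (lim_series_lin _ rF iG).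
  by rewrite addrA.
Qed.

Lemma csum_conj F : csummable F -> csum (fun n => (F n)^*) = (csum F)^*.
Proof.
move=> [_ iF]; rewrite /csum /=; congr Complex.
  by congr (limn (series _)); apply/funext => n /=; case: (F n).
rewrite -lim_seriesN //; congr (limn (series _)).
apply/funext => n /=; rewrite -[RHS]/(- complex.Im (F n)); by case: (F n).
Qed.

Definition square_summable (u : nat -> C) := cvgn (series (sqn \o u)).

(** The majorant 2 |z|^2 |u_n|^2 + 2 |v_n|^2 exceeds |z u_n + v_n|^2 by exactly |z u_n - v_n|^2. *)
Lemma square_summable_lin (z : C) (u v : nat -> C) :
  square_summable u -> square_summable v ->
  square_summable (fun n => z * u n + v n).
Proof.
move=> su sv.
have := cvg_series_lin (2 * sqn z) su (cvg_series_lin 1 sv sv).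
apply: series_le_cvg => n /=.
- exact: sqn_ge0.
- rewrite mul1r; do 2?[apply: addr_ge0]; rewrite ?sqn_ge0 //.
  by do 2?[apply: mulr_ge0]; rewrite ?sqn_ge0.
case: z (u n) (v n) => a b [c d] [e f]; rewrite /sqn /=.
rewrite -subr_ge0 (_ : _ - _ =
  (a * c - b * d - e) ^+ 2 + (a * d + b * c - f) ^+ 2); last by ring.
by rewrite addr_ge0 ?sqr_ge0.
Qed.

(** Real and imaginary parts of the products are bounded by |u_n|^2 + |v_n|^2, so both series
    converge absolutely. *)
Lemma csummable_mul_conj (u v : nat -> C) :
  square_summable u -> square_summable v -> csummable (fun n => u n * (v n)^*).
Proof.
move=> su sv; have cuv := cvg_series_lin 1 su sv.
have dom (f : nat -> R) :
    (forall n, `|f n| <= sqn (u n) + sqn (v n)) -> cvgn (series f).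
  move=> fuv; apply: (@normed_cvg R R^o); apply: series_le_cvg cuv => n //=.
    by rewrite mul1r addr_ge0 ?sqn_ge0.
  by rewrite mul1r.
split; apply: dom => n /=; case: (u n) (v n) => a b [c d];
  rewrite /sqn /= ler_norml; apply/andP; split; rewrite -subr_ge0.
- have := sqr_ge0 (a + c); have := sqr_ge0 (b + d); have := sqr_ge0 a.
  have := sqr_ge0 b; have := sqr_ge0 c; have := sqr_ge0 d; lra.
- have := sqr_ge0 (a - c); have := sqr_ge0 (b - d); have := sqr_ge0 a.
  have := sqr_ge0 b; have := sqr_ge0 c; have := sqr_ge0 d; lra.
- have := sqr_ge0 (a - d); have := sqr_ge0 (b + c); have := sqr_ge0 a.
  have := sqr_ge0 b; have := sqr_ge0 c; have := sqr_ge0 d; lra.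
- have := sqr_ge0 (a + d); have := sqr_ge0 (b - c); have := sqr_ge0 a.
  have := sqr_ge0 b; have := sqr_ge0 c; have := sqr_ge0 d; lra.
Qed.

Lemma square_summable0 : square_summable (fun=> 0).
Proof.
rewrite /square_summable (_ : _ \o _ = fun=> 0); first exact: cvg_series0.
by apply/funext => n; rewrite /sqn /= expr0n addr0.
Qed.

Lemma sqn_partial_le (u : nat -> C) n :
  square_summable u -> \sum_(i < n) sqn (u i) <= limn (series (sqn \o u)).
Proof.
move=> su; rewrite -(big_mkord xpredT (sqn \o u)).
apply: (nondecreasing_cvgn_le (u_ := series (sqn \o u))) => //.
by apply/nondecreasing_seqP => m; rewrite seriesSr lerDl sqn_ge0.
Qed.

Lemma square_summable_bound (u : nat -> C) (M : R) :
  (forall n, \sum_(i < n) sqn (u i) <= M) ->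
  square_summable u /\ limn (series (sqn \o u)) <= M.
Proof.
move=> uM.
have uM' n : series (sqn \o u) n <= M by rewrite /series /= big_mkord.
have su : square_summable u.
  apply: nondecreasing_is_cvgn.
    by apply/nondecreasing_seqP => m; rewrite seriesSr lerDl sqn_ge0.
  by exists M => _ [n _ <-].
by split=> //; apply: limr_le => //; exact: nearW.
Qed.

End SquareSummable.
Arguments cvg_series_lin {R f g} a.
Arguments lim_series_lin {R f g} a.
Arguments sqn_partial_le {R u} n.
Arguments square_summable_lin {R} z {u v}.

Section LittleL2.
Variable R : realType.
Local Notation C := R[i].

Definition l2_pred : {pred nat -> C} := [pred u | `[< square_summable u >]].

Fact l2_submod_closed : submod_closed l2_pred.
Proof.
split; first by apply/asboolP; exact: square_summable0.
by move=> z u v /asboolP su /asboolP sv; apply/asboolP; exact: square_summable_lin.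
Qed.
HB.instance Definition _ := GRing.isSubmodClosed.Build C (nat -> C) l2_pred
  (GRing.submod_closed_semi l2_submod_closed).

Record l2 := L2 { l2_val :> nat -> C; l2_in : l2_val \in l2_pred }.
HB.instance Definition _ := [isSub for l2_val].
HB.instance Definition _ := [Choice of l2 by <:].
HB.instance Definition _ := [SubChoice_isSubLmodule of l2 by <:].
Lemma l2P (u : l2) : square_summable u.
Proof. exact/asboolP/l2_in. Qed.
Arguments l2P : clear implicits.

Definition mk_l2 (u : nat -> C) (su : square_summable u) : l2 :=
  L2 (introT (asboolP _) su).

Lemma l2_linE (z : C) (u v : l2) n : (z *: u + v) n = z * u n + v n.
Proof. by []. Qed.

Lemma l2_ext (u v : l2) : (forall n, u n = v n) -> u = v.
Proof. by move=> uv; apply: val_inj; apply/funext. Qed.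

(* Locked, since comparing two inner products by unfolding is intractable. *)
Definition l2_inner : l2 -> l2 -> C :=
  locked (fun u v : l2 => csum (fun n => u n * (v n)^*)).

Lemma l2_inner_csum (u v : l2) : l2_inner u v = csum (fun n => u n * (v n)^*).
Proof. by rewrite /l2_inner -lock. Qed.

Lemma l2_innerE u :
  l2_inner u u = (limn (series (@sqn R \o u)))%:C%C.
Proof.
rewrite l2_inner_csum /csum; congr Complex.
  congr (limn (series _)); apply/funext => n /=.
  by case: (u n) => a b; rewrite /sqn /=; ring.
rewrite (_ : series _ = fun=> 0) ?lim_cst //; apply/funext => n.
by rewrite /series /= big1 // => i _; case: (u i) => a b /=; ring.
Qed.

Fact l2_inner_bilinear :
  bilinear_for (GRing.Scale.Law.clone _ _ *%R _)
    (GRing.Scale.Law.clone _ _ ( @Num.conj C \; *%R) _) l2_inner.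
Proof.
split=> [w|u] z x y /=; rewrite !l2_inner_csum -csum_lin;
  try (apply: csummable_mul_conj; exact: l2P);
  congr csum; apply/funext => n; rewrite l2_linE.
  by rewrite mulrDl mulrA.
by rewrite rmorphD rmorphM mulrDr mulrCA.
Qed.

Fact l2_inner_herm (u v : l2) : l2_inner u v = (-1) ^+ false * (l2_inner v u)^*.
Proof.
rewrite mul1r !l2_inner_csum -csum_conj; last by apply: csummable_mul_conj; exact: l2P.
by congr csum; apply/funext => n; rewrite rmorphM /= conjCK mulrC.
Qed.

Fact l2_inner_gt0 (u : l2) : u != 0 -> 0 < l2_inner u u.
Proof.
move=> u0; rewrite l2_innerE ltcR lt_neqAle; apply/andP; split; last first.
  by have := sqn_partial_le 0 (l2P u); rewrite big_ord0.
apply: contra_neq u0 => u0; apply: l2_ext => n; apply: sqn_eq0; apply/eqP.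
rewrite eq_le sqn_ge0 andbT; have := sqn_partial_le n.+1 (l2P u).
rewrite -u0 big_ord_recr /=; apply: le_trans.
by rewrite lerDr sumr_ge0 // => i _; exact: sqn_ge0.
Qed.

HB.instance Definition _ := bilinear_isBilinear.Build C l2 l2 C _ _ l2_inner
  l2_inner_bilinear.
HB.instance Definition _ := isHermitianSesquilinear.Build C l2 false _ l2_inner
  l2_inner_herm.
HB.instance Definition _ := isDotProduct.Build C l2 l2_inner l2_inner_gt0.
Definition l2_dot : {dot l2 for @Num.conj C} := l2_inner.

Lemma l2_inner_linl (u v w : l2) z :
  l2_inner (z *: v + w) u = z * l2_inner v u + l2_inner w u.
Proof. by have [h _] := l2_inner_bilinear; rewrite h. Qed.

Lemma l2_inner_linr (u v w : l2) z :
  l2_inner u (z *: v + w) = z^* * l2_inner u v + l2_inner u w.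
Proof. by have [_ h] := l2_inner_bilinear; rewrite h. Qed.

Lemma l2_inner0l u : l2_inner 0 u = 0.
Proof. by have := l2_inner_linl u 0 0 (-1); rewrite scaler0 addr0 mulN1r addNr. Qed.

Lemma l2_inner0r u : l2_inner u 0 = 0.
Proof.
by have := l2_inner_linr u 0 0 (-1); rewrite scaler0 addr0 rmorphN1 mulN1r addNr.
Qed.

Lemma l2_inner_linr2 (u v w : l2) a b :
  l2_inner u (a *: v + b *: w) = a^* * l2_inner u v + b^* * l2_inner u w.
Proof. by rewrite l2_inner_linr -[b *: w]addr0 l2_inner_linr l2_inner0r addr0. Qed.

Lemma l2_inner_conj u v : l2_inner u v = (l2_inner v u)^*.
Proof. by rewrite l2_inner_herm mul1r. Qed.

Definition l2_norm (u : l2) : C := sqrtC (l2_inner u u).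

Fact l2_normD u v : l2_norm (u + v) <= l2_norm u + l2_norm v.
Proof. exact: (dot_triangle l2_dot). Qed.
Fact l2_normZ (z : C) u : l2_norm (z *: u) = `|z| * l2_norm u.
Proof.
rewrite /l2_norm [l2_inner _ _](dnormZ l2_dot) sqrtCM ?nnegrE ?exprn_ge0 //.
by rewrite sqrCK.
Qed.
Fact l2_norm_eq0 u : l2_norm u = 0 -> u = 0.
Proof. by move=> /eqP; rewrite sqrtC_eq0 (dnorm_eq0 l2_dot) => /eqP. Qed.

HB.instance Definition _ := Lmodule_isNormed.Build C l2 l2_normD l2_normZ l2_norm_eq0.
End LittleL2.
Arguments l2P {R} u.

(** * Completeness of l^2 *)

Section L2Complete.
Variable R : realType.
Local Notation C := R[i].
Implicit Types (u v : l2 R) (e r : R).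

Lemma realC_gt0 (z : C) : 0 < z -> exists2 e, 0 < e & z = e%:C%C.
Proof.
case: z => a b; rewrite ltcE /= => /andP[/eqP-> a0]; by exists a.
Qed.

(** Bounds on finite partial sums, unlike the norm itself, pass to coordinatewise limits. *)
Lemma l2_norm_le u e : 0 <= e ->
  `|u| <= e%:C%C <-> forall n, \sum_(i < n) sqn (u i) <= e ^+ 2.
Proof.
move=> e0; rewrite -[`|u|]/(l2_norm u).
rewrite -ler_sqr ?nnegrE ?sqrtC_ge0 ?(dnorm_ge0 (l2_dot R)) ?ler0c //.
rewrite sqrtCK l2_innerE -rmorphXn /= lecR; split=> [h n|h].
  exact: le_trans (sqn_partial_le n (l2P u)) h.
by have [] := square_summable_bound h.
Qed.

Lemma l2_coord_le u n e : 0 <= e -> `|u| <= e%:C%C ->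
  `|complex.Re (u n)| <= e /\ `|complex.Im (u n)| <= e.
Proof.
move=> e0 /(l2_norm_le _ e0)/(_ n.+1); rewrite big_ord_recr /= => ue.
have : sqn (u n) <= e ^+ 2.
  by apply: le_trans ue; rewrite lerDr sumr_ge0 // => i _; exact: sqn_ge0.
rewrite /sqn => une; split; rewrite -ler_sqr ?nnegrE // real_normK ?num_real //;
  apply: le_trans une; by rewrite ?lerDl ?lerDr sqr_ge0.
Qed.

(** The coordinates converge along F because [R] is complete; the candidate limit [l] collects these
    limits, and norm bounds between members of F carry over to [l] through partial sums. *)
Lemma l2_cauchy_cvg (F : set_system (l2 R)) : ProperFilter F -> cauchy F -> cvg F.
Proof.
move=> FF /cauchyP Fc.
have Fball e : 0 < e -> exists u, F (ball u e%:C%C).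
  by move=> e0; apply: Fc; rewrite ltcR.
(* [p] stands for the real or the imaginary part. *)
have coord_cvg (p : C -> R) n : (forall z w, p (z - w) = p z - p w) ->
    (forall u e, 0 <= e -> `|u| <= e%:C%C -> `|p (u n)| <= e) ->
    (fun u : l2 R => p (u n)) @ F --> lim ((fun u : l2 R => p (u n)) @ F).
  move=> pB p_le; apply: cauchy_cvg; apply/cauchy_ballP => _/posnumP[e].
  have e20 : 0 < e%:num / 2 / 2 by [].
  have [u Fu] := Fball _ e20.
  have Fp : F [set v : l2 R | ball (p (u n)) (e%:num / 2) (p (v n))].
    apply: filterS Fu => v; rewrite -ball_normE /= => /ltW /(p_le _ _ (ltW e20)).
    rewrite -ball_normE /= -pB; move/le_lt_trans; apply.
    by rewrite ltr_pdivrMr // ltr_pMr // ltr1n.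
  exists (ball (p (u n)) (e%:num / 2), ball (p (u n)) (e%:num / 2)).
    by split; exact: Fp.
  move=> [x y] [/= xu yu]; rewrite [e%:num]splitr.
  exact: ball_triangle (ball_sym xu) yu.
pose l n := Complex (lim ((fun u : l2 R => complex.Re (u n)) @ F))
                    (lim ((fun u : l2 R => complex.Im (u n)) @ F)).
have lE n : ((fun u : l2 R => complex.Re (u n)) @ F --> complex.Re (l n)) /\
            ((fun u : l2 R => complex.Im (u n)) @ F --> complex.Im (l n)).
  split; apply: coord_cvg; try by case=> ? ? [? ?].
  - by move=> u e e0 ue; case: (l2_coord_le n e0 ue).
  - by move=> u e e0 ue; case: (l2_coord_le n e0 ue).
(* For fixed n the partial sum is a continuous function of finitely many coordinates, so the closed
   bound survives the limit along F. *)
have key e u : 0 < e -> F (ball u e%:C%C) ->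
    forall n, \sum_(i < n) sqn (u i - l i) <= e ^+ 2.
  move=> e0 Fu n.
  apply: (@closed_cvg _ _ F _ (fun v : l2 R => \sum_(i < n) sqn (u i - v i))
    [set x | x <= e ^+ 2]) => //.
    apply: filterS Fu => v; rewrite -ball_normE /= => /ltW uv.
    by move/(l2_norm_le _ (ltW e0)): uv; apply.
  elim: n => [|n IH].
    rewrite big_ord0 (_ : (fun=> _) = fun=> 0); first exact: cvg_cst.
    by apply/funext => v; rewrite big_ord0.
  rewrite big_ord_recr /= (_ : (fun _ => _) = fun v : l2 R =>
     \sum_(i < n) sqn (u i - v i) + sqn (u n - v n)); last first.
    by apply/funext => v; rewrite big_ord_recr.
  apply: cvgD => //; rewrite /sqn.
  have [lr li] := lE n.
  have sub (f : l2 R -> R) x a : f @ F --> x ->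
      (fun v => (a - f v) ^+ 2) @ F --> (a - x) ^+ 2.
    by move=> fx; apply: cvgM; apply: cvgB => //; exact: cvg_cst.
  rewrite (_ : (fun v => _) = fun v : l2 R =>
    (complex.Re (u n) - complex.Re (v n)) ^+ 2 +
    (complex.Im (u n) - complex.Im (v n)) ^+ 2); last first.
    by apply/funext => v; case: (u n) (v n) => ? ? [? ?].
  rewrite (_ : _ + _ = (complex.Re (u n) - complex.Re (l n)) ^+ 2 +
    (complex.Im (u n) - complex.Im (l n)) ^+ 2); last first.
    by case: (u n) => ? ?.
  by apply: cvgD; apply: sub.
have [u0 Fu0] := Fball 1 ltr01.
(* Both u0 - l and u0 are square summable, hence so is l = u0 - (u0 - l). *)
have ls : square_summable l.
  have [sul _] := @square_summable_bound R (fun n => u0 n - l n) _ (key _ _ ltr01 Fu0).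
  have := square_summable_lin (-1) sul (l2P u0).
  by rewrite (_ : (fun n => _) = l) //; apply/funext => n; ring.
suff : F --> mk_l2 ls by exact: cvgP.
apply/cvg_ballP => z /realC_gt0[e e0 ->].
have e20 : 0 < e / 2 by rewrite divr_gt0.
have [u Fu] := Fball _ e20.
have ul : `|u - mk_l2 ls| <= (e / 2)%:C%C by apply/(l2_norm_le _ (ltW e20)); exact: key.
apply: filterS Fu => v; rewrite -!ball_normE /= => uv.
rewrite [e]splitr rmorphD /= -(subrKA u) (le_lt_trans (ler_normD _ _)) //.
by rewrite ler_ltD // distrC.
Qed.

HB.instance Definition _ := Uniform_isComplete.Build (l2 R) l2_cauchy_cvg.

Definition l2_hilbert : hilbertSpace C.
Proof.
refine (@HilbertSpace C (l2 R : completeNormedModType C) (l2_dot R) _).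
by move=> u; rewrite -[`|u|]/(l2_norm u) sqrtCK.
Defined.

End L2Complete.

Lemma l2_hilbert_innerE (R : realType) (u v : l2 R) :
  inner (l2_hilbert R) u v = l2_inner u v.
Proof. by []. Qed.

(** * Finitely supported sequences and their density *)

Section FiniteSupport.
Variable R : realType.
Local Notation C := R[i].
Implicit Types (u v : l2 R).

Lemma series_finite (f : nat -> R) N : (forall n, (N <= n)%N -> f n = 0) ->
  cvgn (series f) /\ limn (series f) = \sum_(i < N) f i.
Proof.
move=> f0.
have h : \forall n \near \oo, series f n = \sum_(i < N) f i.
  exists N => // n /= Nn; rewrite /series /= -(big_mkord xpredT f).
  rewrite [RHS](big_nat_widen _ _ _ _ _ Nn) big_mkcond [RHS]big_mkcond /=.
  by apply: eq_bigr => i _; case: ltnP => // /f0.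
by split; [exact: is_cvg_near_cst h|exact: lim_near_cst h].
Qed.

Lemma csum_finite (F : nat -> C) N : (forall n, (N <= n)%N -> F n = 0) ->
  csum F = \sum_(i < N) F i.
Proof.
move=> F0; rewrite /csum.
have [|_ ->] := @series_finite (@complex.Re R \o F) N; first by move=> n /F0 /= ->.
have [|_ ->] := @series_finite (@complex.Im R \o F) N; first by move=> n /F0 /= ->.
elim: N {F0} => [|N IH]; first by rewrite !big_ord0.
by rewrite !big_ord_recr /= -IH; case: (F N).
Qed.

Definition finsupp (u : nat -> C) := exists N, forall n, (N <= n)%N -> u n = 0.

Lemma finsupp_summable (f : nat -> C) : finsupp f -> square_summable f.
Proof.
move=> [N f0]; have [|] // := @series_finite (@sqn R \o f) N.
by move=> n /f0 /= ->; rewrite /sqn /= expr0n addr0.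
Qed.

(* Extended by the junk value 0 to sequences that are not square summable. *)
Definition to_l2 : (nat -> C) -> l2 R := locked (insubd (0 : l2 R)).

Lemma to_l2K (f : nat -> C) : finsupp f -> to_l2 f = f :> (nat -> C).
Proof.
move=> /finsupp_summable su; rewrite /to_l2 -lock; apply: insubdK.
exact/asboolP.
Qed.

Definition delta_seq n : nat -> C := fun i => (i == n)%:R.

Lemma finsupp_delta n : finsupp (delta_seq n).
Proof. by exists n.+1 => i ni; rewrite /delta_seq gtn_eqF. Qed.

Lemma inner_delta u n : l2_inner u (to_l2 (delta_seq n)) = u n.
Proof.
rewrite l2_inner_csum to_l2K; last exact: finsupp_delta.
rewrite (@csum_finite _ n.+1); last first.
  by move=> i ni; rewrite /delta_seq gtn_eqF // conjC0 mulr0.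
rewrite big_ord_recr big1 /=.
  by rewrite /delta_seq eqxx conjC1 mulr1 add0r.
by move=> i _; rewrite /delta_seq ltn_eqF // conjC0 mulr0.
Qed.

Lemma l2_sumE I (r : seq I) (F : I -> l2 R) n :
  (\sum_(i <- r) F i) n = \sum_(i <- r) F i n.
Proof. by elim/big_rec2 : _ => // i x y _ <-. Qed.

Lemma l2_scaleE (z : C) u n : (z *: u) n = z * u n.
Proof. by []. Qed.

Lemma finsupp_decomp u N : (forall n, (N <= n)%N -> u n = 0) ->
  u = \sum_(i < N) u i *: to_l2 (delta_seq i).
Proof.
move=> u0; apply: l2_ext => n; rewrite l2_sumE.
under eq_bigr => i _.
  rewrite l2_scaleE to_l2K; last exact: finsupp_delta.
  over.
have [nN|Nn] := ltnP n N; last first.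
  rewrite u0 // big1 // => i _; rewrite /delta_seq gtn_eqF ?mulr0 //.
  exact: leq_trans (ltn_ord i) Nn.
rewrite (bigD1 (Ordinal nN)) //= /delta_seq eqxx mulr1 big1 ?addr0 // => i.
by rewrite -val_eqE /= eq_sym => /negbTE->; rewrite mulr0.
Qed.

(** The approximant is the truncation of u at an N for which the tail of the sum of |u_n|^2 is below
    (e/2)^2. *)
Lemma finsupp_dense : dense [set u : l2 R | finsupp u].
Proof.
move=> O [u Ou] oO; have /nbhs_ballP[z /= /realC_gt0[e e0 ->] Oe] : nbhs u O.
  exact: open_nbhs_nbhs.
have su := l2P u.
have e20 : 0 < e / 2 by rewrite divr_gt0.
have /cvgrPdist_lt/(_ _ (exprn_gt0 2 e20)) [N _ /(_ N (leqnn N))] := su.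
move=> /= /(le_lt_trans (ler_norm _)) LN.
pose t n := if (n < N)%N then u n else 0.
have ft : finsupp t by exists N => n; rewrite /t leqNgt => /negbTE->.
exists (to_l2 t); split; last by rewrite /= to_l2K.
apply: Oe; rewrite -ball_normE /=; apply: (@le_lt_trans _ _ (e / 2)%:C%C); last first.
  by rewrite ltcR ltr_pdivrMr // ltr_pMr // ltr1n.
apply/(l2_norm_le _ (ltW e20)) => n.
have wE i : (u - to_l2 t) i = if (i < N)%N then 0 else u i.
  rewrite -[LHS]/(u i - to_l2 t i) to_l2K // /t; case: ifP => _; first exact: subrr.
  exact: subr0.
move: (u - to_l2 t) wE => w wE.
apply: le_trans (ltW LN); rewrite lerBrDr.
apply: le_trans (sqn_partial_le (N + n) su).
have -> : \sum_(i < N + n) sqn (u i) =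
    \sum_(i < N + n) sqn (w i) + series (@sqn R \o u) N.
  rewrite /series /= big_mkord !big_split_ord /= [X in _ = X + _]addrC -addrA.
  rewrite [X in _ + (X + _)]big1 ?add0r; last first.
    by move=> i _; rewrite wE ltn_ord /sqn /= expr0n addr0.
  rewrite [RHS]addrC; congr (_ + _); apply: eq_bigr => i _.
  by rewrite wE ltnNge leq_addr.
rewrite lerD2r addnC big_split_ord /= lerDl sumr_ge0 // => i _; exact: sqn_ge0.
Qed.
End FiniteSupport.

(** * The representation *)

(** This bijection realizes l^2(N x N) on the space [l2] of sequences indexed by N. *)
Lemma nat_pairing : exists (f : nat -> nat * nat) (g : nat * nat -> nat),
  cancel f g /\ cancel g f.
Proof.
have /card_esym/ppcard_eqP[f] := card_nat2.
exists f, (f^-1)%FUN; split => x; first by rewrite funK // inE.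
by rewrite invK // inE.
Qed.

(** * The weighted action on arbitrary functions on N x N *)

Section WeightedAction.
Variables (R : realType) (q : R) (al be : nat -> nat -> R).
Local Notation C := R[i].
Implicit Types (F G : nat -> nat -> C).

(** The operator a e_{k,j} = al_{k,j} e_{k,j+1} + be_{k,j} e_{k-1,j} written on the coefficients
    F_{k,j}; [wcre] is its formal adjoint. *)
Definition wann F k j : C :=
  (if j is i.+1 then (al k i)%:C%C * F k i else 0) + (be k.+1 j)%:C%C * F k.+1 j.

Definition wcre F k j : C :=
  (al k j)%:C%C * F k j.+1 + (if k is i.+1 then (be k j)%:C%C * F i j else 0).

(** Linear combinations get a name so that linearity of the action becomes a rewriting rule. *)
Definition scale_add (s : C) F G k j : C := s * F k j + G k j.

Fixpoint wact (x : qexpr C) F : nat -> nat -> C :=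
  match x with
  | Qann => wann F
  | Qcre => wcre F
  | Qconst s => fun k j => s * F k j
  | Qadd y z => fun k j => wact y F k j + wact z F k j
  | Qmul y z => wact y (wact z F)
  end.

Lemma fun2_ext F G : (forall k j, F k j = G k j) -> F = G.
Proof. by move=> FG; apply/funext => k; apply/funext. Qed.

Lemma wact_lin x s F G :
  wact x (scale_add s F G) = scale_add s (wact x F) (wact x G).
Proof.
elim: x F G => [||t|y IHy z IHz|y IHy z IHz] F G /=.
- by apply: fun2_ext => k [|j]; rewrite /wann /scale_add; ring.
- by apply: fun2_ext => -[|k] j; rewrite /wcre /scale_add; ring.
- by apply: fun2_ext => k j; rewrite /scale_add; ring.
- by rewrite IHy IHz; apply: fun2_ext => k j; rewrite /scale_add; ring.
- by rewrite IHz IHy.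
Qed.

Lemma scale_addE1 F G : (fun k j => F k j + G k j) = scale_add 1 F G.
Proof. by apply: fun2_ext => k j; rewrite /scale_add mul1r. Qed.

Definition fun2_0 : nat -> nat -> C := fun _ _ => 0.

Lemma wact0 x : wact x fun2_0 = fun2_0.
Proof.
have e : fun2_0 = scale_add (-1) fun2_0 fun2_0.
  by apply: fun2_ext => k j; rewrite /scale_add mulN1r addNr.
rewrite {1}e wact_lin; apply: fun2_ext => k j.
by rewrite /scale_add mulN1r addNr.
Qed.

Lemma scale_addE2 s F : (fun k j => s * F k j) = scale_add s F fun2_0.
Proof. by apply: fun2_ext => k j; rewrite /scale_add addr0. Qed.

Hypothesis be0 : forall j, be 0%N j = 0.
Hypothesis al_be_diag : forall k j, before (fun i => al k i ^+ 2) j + be k.+1 j ^+ 2 =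
  q * (al k j ^+ 2 + be k j ^+ 2) + 1.
Hypothesis al_be_off : forall k j, be k.+1 j * al k.+1 j = q * (al k j * be k.+1 j.+1).

(** The difference of the two sides involves F only at (k,j), (k+1,j+1) and, away from the boundary,
    (k-1,j-1). The first coefficient vanishes by [al_be_diag], the others by [al_be_off] at (k,j)
    and (k-1,j-1). *)
Lemma wann_wcre F k j :
  wann (wcre F) k j = q%:C%C * wcre (wann F) k j + F k j.
Proof.
have toC (x y : R) : x = y -> x%:C%C - y%:C%C = 0 by move=> ->; rewrite subrr.
have := toC _ _ (al_be_diag k j); have := toC _ _ (al_be_off k j).
rewrite !(rmorphD, rmorphM, rmorphXn) /= => O1 D.
apply/eqP; rewrite -subr_eq0; apply/eqP; move: D O1.
case: j k => [|j] [|k]; rewrite /wann /wcre /before ?be0 => D O1.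
- move: D O1; set d := (X in X = 0 -> _) => D; set o := (X in X = 0 -> _) => O1.
  transitivity (d * F 0%N 0%N + o * F 1%N 1%N); first by rewrite /d /o; ring.
  by rewrite D O1 !mul0r addr0.
- move: D O1; set d := (X in X = 0 -> _) => D; set o := (X in X = 0 -> _) => O1.
  transitivity (d * F k.+1 0%N + o * F k.+2 1%N); first by rewrite /d /o; ring.
  by rewrite D O1 !mul0r addr0.
- move: D O1; set d := (X in X = 0 -> _) => D; set o := (X in X = 0 -> _) => O1.
  transitivity (d * F 0%N j.+1 + o * F 1%N j.+2); first by rewrite /d /o; ring.
  by rewrite D O1 !mul0r addr0.
- have := toC _ _ (al_be_off k j); rewrite !rmorphM /=.
  set p := (X in X = 0 -> _) => O2; move: D O1.
  set d := (X in X = 0 -> _) => D; set o := (X in X = 0 -> _) => O1.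
  transitivity (d * F k.+1 j.+1 + o * F k.+2 j.+2 + p * F k j).
    by rewrite /d /o /p; ring.
  by rewrite D O1 O2 !mul0r !addr0.
Qed.

Lemma wact_cong x y : qcong q x y -> wact x = wact y.
Proof.
have ext x' y' : (forall F k j, wact x' F k j = wact y' F k j) -> wact x' = wact y'.
  by move=> h; apply: funext => F; exact: fun2_ext.
elim=> {x y} //.
- by move=> x y z _ -> _ ->.
- by move=> x x' y y' _ /= -> _ ->.
- by move=> x x' y y' _ /= -> _ ->.
- by move=> x y z; apply: ext => F k j /=; rewrite addrA.
- by move=> x y; apply: ext => F k j /=; rewrite addrC.
- by move=> x; apply: ext => F k j /=; rewrite mul0r add0r.
- by move=> x; apply: ext => F k j /=; rewrite mul0r mulN1r addNr.
- by move=> x; apply: ext => F k j /=; rewrite mul1r.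
- move=> x y z; apply: ext => F k j /=.
  by rewrite scale_addE1 wact_lin /scale_add mul1r.
- by move=> s t; apply: ext => F k j /=; rewrite mulrDl.
- by move=> s t; apply: ext => F k j /=; rewrite mulrA.
- move=> s x; apply: ext => F k j /=.
  by rewrite scale_addE2 wact_lin wact0 /scale_add addr0.
- by apply: ext => F k j /=; rewrite wann_wcre mul1r.
Qed.

End WeightedAction.

(** * The operators on finitely supported vectors of l^2 *)

Section FiniteSupport2.
Variables (R : realType) (al be : nat -> nat -> R).
Local Notation C := R[i].
Local Notation wact := (wact al be).
Local Notation H := (l2 R).
Implicit Types (F G : nat -> nat -> C).

(** Triangles k + j < N suit the generators, each of which enlarges the support by at most one
    antidiagonal. *)
Definition finsupp2 F := exists N, forall k j, (N <= k + j)%N -> F k j = 0.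

Lemma finsupp2_lin s F G : finsupp2 F -> finsupp2 G -> finsupp2 (scale_add s F G).
Proof.
move=> [M FM] [N GN]; exists (maxn M N) => k j; rewrite geq_max => /andP[hM hN].
by rewrite /scale_add FM // GN // mulr0 addr0.
Qed.

Lemma finsupp2_wact x F : finsupp2 F -> finsupp2 (wact x F).
Proof.
elim: x F => [||t|y IHy z IHz|y IHy z IHz] F fF /=.
- have [N F0] := fF; exists N.+1 => k [|j] kj; rewrite /wann !F0 ?mulr0 ?addr0 //; lia.
- have [N F0] := fF; exists N.+1 => -[|k] j kj; rewrite /wcre !F0 ?mulr0 ?addr0 //; lia.
- by have [N F0] := fF; exists N => k j kj; rewrite F0 ?mulr0.
- by rewrite scale_addE1; apply: finsupp2_lin; [exact: IHy|exact: IHz].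
- exact/IHy/IHz.
Qed.

Variables (unpair : nat -> nat * nat) (pair : nat * nat -> nat).
Hypotheses (unpairK : cancel unpair pair) (pairK : cancel pair unpair).

Definition unflat (u : nat -> C) k j : C := u (pair (k, j)).
Definition flat F n : C := F (unpair n).1 (unpair n).2.

Lemma flatK F : unflat (flat F) = F.
Proof. by apply: fun2_ext => k j; rewrite /flat /unflat pairK. Qed.

Lemma finsupp_flat F : finsupp2 F -> finsupp (flat F).
Proof.
move=> [N F0].
exists (\max_(i < N) \max_(j < N) pair (i : nat, j : nat)).+1 => n hn.
rewrite /flat; apply: F0; rewrite leqNgt; apply/negP => kj.
have hk : ((unpair n).1 < N)%N by apply: leq_ltn_trans kj; exact: leq_addr.
have hj : ((unpair n).2 < N)%N by apply: leq_ltn_trans kj; exact: leq_addl.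
move: hn; apply/negP; rewrite -ltnNge ltnS.
apply: leq_trans (leq_bigmax (Ordinal hk)).
apply: leq_trans (leq_bigmax (Ordinal hj)).
by rewrite -surjective_pairing unpairK.
Qed.

Lemma finsupp_unflat u : finsupp u -> finsupp2 (unflat u).
Proof.
move=> [N u0].
exists (\max_(n < N) ((unpair n).1 + (unpair n).2)).+1 => k j kj.
rewrite /unflat; apply: u0; rewrite leqNgt; apply/negP => hn.
move: kj; apply/negP; rewrite -ltnNge ltnS.
by apply: leq_trans (leq_bigmax (Ordinal hn)); rewrite pairK.
Qed.

Definition wop (x : qexpr C) (u : H) : H := to_l2 (flat (wact x (unflat u))).

Lemma wopE x (u : H) : finsupp u -> wop x u = flat (wact x (unflat u)) :> (nat -> C).
Proof.
by move=> fu; apply/to_l2K/finsupp_flat/finsupp2_wact/finsupp_unflat.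
Qed.

Lemma finsupp_wop x (u : H) : finsupp u -> finsupp (wop x u).
Proof.
by move=> fu; rewrite wopE //; apply/finsupp_flat/finsupp2_wact/finsupp_unflat.
Qed.

Lemma unflat_wop x (u : H) : finsupp u -> unflat (wop x u) = wact x (unflat u).
Proof. by move=> fu; rewrite wopE // flatK. Qed.

Lemma finsupp_lin z (u v : H) : finsupp u -> finsupp v -> finsupp (z *: u + v).
Proof.
move=> [M uM] [N vN]; exists (maxn M N) => n; rewrite geq_max => /andP[hM hN].
by rewrite l2_linE uM // vN // mulr0 addr0.
Qed.

Lemma finsupp0 : finsupp (0 : H).
Proof. by exists 0%N. Qed.

Lemma wop_lin x z (u v : H) : finsupp u -> finsupp v ->
  wop x (z *: u + v) = z *: wop x u + wop x v.
Proof.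
move=> fu fv; apply: l2_ext => n; rewrite l2_linE !wopE //; last exact: finsupp_lin.
rewrite (_ : unflat _ = scale_add z (unflat u) (unflat v)) ?wact_lin //.
Qed.

(** Reduces statements that are linear or antilinear in v to the basis vectors. *)
Lemma finsupp_ind (P : H -> Prop) : P 0 ->
  (forall z n (v : H), finsupp v -> P v -> P (z *: to_l2 (delta_seq R n) + v)) ->
  forall v : H, finsupp v -> P v.
Proof.
move=> P0 PD v [N /finsupp_decomp ->].
suff [] : finsupp (\sum_(i < N) v i *: to_l2 (delta_seq R i) : H) /\
   P (\sum_(i < N) v i *: to_l2 (delta_seq R i)) by [].
elim: N => [|N [fN PN]]; first by rewrite big_ord0; split=> //; exact: finsupp0.
have -> : \sum_(i < N.+1) v i *: to_l2 (delta_seq R i) =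
    v N *: to_l2 (delta_seq R N) + \sum_(i < N) v i *: to_l2 (delta_seq R i) :> l2 R.
  by rewrite big_ord_recr /= addrC.
split; last exact: PD.
by apply: finsupp_lin => //; rewrite to_l2K; exact: finsupp_delta.
Qed.

Lemma delta_pair k j k' j' : unflat (delta_seq R (pair (k, j))) k' j' =
  ((k' == k) && (j' == j))%:R.
Proof.
rewrite /unflat /delta_seq (inj_eq (can_inj pairK)) xpair_eqE //.
Qed.

Hypothesis be0 : forall j, be 0%N j = 0.

(** At j = 0 the index [j.-1] is a dummy, since its coefficient is 0. *)
Lemma wop_cre_delta k j : wop Qcre (to_l2 (delta_seq R (pair (k, j)))) =
  (if j is i.+1 then (al k i)%:C%C else 0) *: to_l2 (delta_seq R (pair (k, j.-1))) +
  (be k.+1 j)%:C%C *: to_l2 (delta_seq R (pair (k.+1, j))).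
Proof.
apply: l2_ext => n; rewrite l2_linE l2_scaleE wopE; last first.
  by rewrite to_l2K; exact: finsupp_delta.
rewrite !to_l2K; try exact: finsupp_delta.
have -> : n = pair (unpair n) by rewrite unpairK.
case: (unpair n) => a b; rewrite -[X in _ = _ * X + _]/(unflat _ a b).
rewrite -[X in _ = _ + _ * X]/(unflat _ a b) /flat pairK /= /wcre !delta_pair.
case: a j => [|a] [|j]; rewrite ?delta_pair ?eqSS /= ?andbF;
  rewrite ?mulr0 ?add0r ?addr0 ?mul0r //.
- by case: eqVneq => [<-|_]; case: eqVneq => [<-|_]; rewrite ?mulr0 ?addr0.
- rewrite add0r; case: eqVneq => [<-|_]; case: eqVneq => [<-|_];
    by rewrite ?mulr0 ?addr0.
- congr (_ + _).
    by case: eqVneq => [<-|_]; case: eqVneq => [<-|_]; rewrite ?mulr0 ?addr0.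
  by case: eqVneq => [<-|_]; case: eqVneq => [<-|_]; rewrite ?mulr0 ?addr0.
Qed.

Lemma wop0 x : wop x 0 = 0.
Proof.
have := wop_lin x (-1) finsupp0 finsupp0.
by rewrite !scaleN1r !addNr.
Qed.

Lemma conj_real (x : R) : (x%:C%C)^* = x%:C%C :> C.
Proof. by apply/CrealP; rewrite complex_real. Qed.

(** For v a basis vector the left side is one coefficient of [wop Qann u], and the right side pairs
    u with the two terms of [wop_cre_delta]. *)
Lemma wop_ann_adj (u v : H) : finsupp u -> finsupp v ->
  l2_inner (wop Qann u) v = l2_inner u (wop Qcre v).
Proof.
move=> fu; elim/finsupp_ind => [|z n w fw IH]; first by rewrite wop0 !l2_inner0r.
have fd m : finsupp (to_l2 (delta_seq R m)) by rewrite to_l2K; exact: finsupp_delta.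
rewrite (wop_lin Qcre z (fd n) fw).
rewrite [LHS](l2_inner_linr _ _ w).
rewrite [RHS](l2_inner_linr _ _ (wop Qcre w)).
refine (congr2 (fun a b => z^* * a + b) _ IH).
rewrite (inner_delta (wop Qann u) n) (wopE Qann fu).
rewrite -(unpairK n); case: (unpair n) => k j; rewrite /flat pairK wop_cre_delta.
rewrite l2_inner_linr2 !inner_delta conj_real.
case: j => [|j]; rewrite [LHS]/wann /unflat; first by rewrite conjC0 mul0r.
by rewrite conj_real.
Qed.

Lemma wop_const s (u : H) : finsupp u -> wop (Qconst s) u = s *: u.
Proof.
move=> fu; apply: l2_ext => n; rewrite l2_scaleE wopE //.
by rewrite /flat /unflat /= -surjective_pairing unpairK.
Qed.

Lemma wop_add x y (u : H) : finsupp u -> wop (Qadd x y) u = wop x u + wop y u.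
Proof.
move=> fu; apply: l2_ext => n.
by rewrite -[wop x u in RHS]scale1r l2_linE mul1r !wopE.
Qed.

Lemma wop_mul x y (u : H) : finsupp u -> wop (Qmul x y) u = wop x (wop y u).
Proof.
move=> fu; apply: l2_ext => n.
by rewrite (wopE _ fu) (wopE x (finsupp_wop y fu)) (unflat_wop y fu).
Qed.

Lemma wop_adj x (u v : H) : finsupp u -> finsupp v ->
  l2_inner (wop x u) v = l2_inner u (wop (qstar x) v).
Proof.
elim: x u v => [||t|y IHy z IHz|y IHy z IHz] u v fu fv.
- exact: wop_ann_adj.
- by rewrite l2_inner_conj -wop_ann_adj // -l2_inner_conj.
- rewrite !wop_const // -[t *: u]addr0 -[t^* *: v]addr0.
  by rewrite l2_inner_linr l2_inner_linl l2_inner0r l2_inner0l conjCK.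
- rewrite !wop_add // -[wop y u]scale1r -[X in l2_inner u (X + _)]scale1r.
  by rewrite l2_inner_linr l2_inner_linl conjC1 !mul1r IHy // IHz.
- rewrite [LHS](congr1 (fun t => l2_inner t v) (wop_mul y z fu)).
  rewrite [RHS](congr1 (l2_inner u) (wop_mul _ _ fv)).
  by rewrite IHy ?IHz; [|try exact: finsupp_wop..].
Qed.

End FiniteSupport2.

(** * Positivity of spectral integrals *)

Section ConcentratedIntegral.
Local Open Scope ereal_scope.
Context d (T : measurableType d) (R : realType).
Variables (mu : set T -> \bar R) (X : set T).
Hypothesis mu_ge0 : forall U, measurable U -> 0 <= mu U.
Hypothesis mu_out : forall U, measurable U -> U `&` X = set0 -> mu U = 0.

Import HBNNSimple.

Let sintegral_ge0_raw (h : {nnsfun T >-> R}) : 0 <= sintegral mu h.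
Proof.
apply: fsume_ge0 => r _; have [r0|r0] := leP 0%R r.
  by rewrite mule_ge0 ?lee_fin ?mu_ge0.
(* A negative value has an empty preimage under h, where [mu] is 0. *)
rewrite mu_out ?mule0 //; apply/seteqP; split=> // t [/= ht _].
have h0 : (0 <= h t)%R by exact: fun_ge0.
by move: h0; rewrite ht leNgt r0.
Qed.

Let sintegral_null (h : {nnsfun T >-> R}) :
  (forall t, X t -> h t = 0%R) -> sintegral mu h = 0.
Proof.
move=> h0; apply: fsbig1 => r _; have [->|r0] := eqVneq r 0%R; first by rewrite mul0e.
rewrite mu_out ?mule0 //; apply/seteqP; split=> // t [/= ht Xt].
by move: r0; rewrite -ht h0 ?eqxx.
Qed.

(** The integral of a nonnegative function in unfolded form, which makes sense for a set function
    not known to be a measure. *)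
Let nnint (f : T -> \bar R) := ereal_sup [set sintegral mu h |
  h in [set h : {nnsfun T >-> R} | forall x, (h x)%:E <= f x]].

Let nnint_ge0 f : (forall x, 0 <= f x) -> 0 <= nnint f.
Proof.
move=> f0; apply: le_trans (sintegral_ge0_raw nnsfun0) _.
by apply: ereal_sup_ubound; exists nnsfun0.
Qed.

Let nnint_null f : (forall x, 0 <= f x) -> (forall x, X x -> f x = 0) -> nnint f = 0.
Proof.
move=> f0 fX; apply/eqP; rewrite eq_le nnint_ge0 // andbT.
apply: ge_ereal_sup => _ [h /= hf <-]; rewrite sintegral_null // => t Xt.
by apply/eqP; rewrite eq_le fun_ge0 andbT -lee_fin (le_trans (hf t)) // fX.
Qed.

(** The negative part of g vanishes on X, so every simple function below it does too and its
    integral is 0; the integral of the positive part remains. *)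
Lemma integral_ge0_on (g : T -> R) : (forall t, X t -> (0 <= g t)%R) ->
  0 <= \int[mu]_t (g t)%:E.
Proof.
move=> g0; rewrite /integral patch_setT -/(nnint _) -/(nnint _).
rewrite [X in _ - X]nnint_null ?sube0 => [|x|t Xt]; last 2 first.
- exact: funeneg_ge0.
- by rewrite funenegE -EFinN -EFin_max; congr EFin; apply/max_idPr; rewrite oppr_le0 g0.
by apply: nnint_ge0 => x; exact: funepos_ge0.
Qed.

Lemma integral_eq0_on (g : T -> R) : (forall t, X t -> g t = 0%R) ->
  \int[mu]_t (g t)%:E = 0.
Proof.
move=> g0; rewrite /integral patch_setT -/(nnint _) -/(nnint _).
rewrite !nnint_null ?sube0 // => t Xt; rewrite ?funenegE ?funeposE g0 ?oppe0 ?maxxx //.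
Qed.
End ConcentratedIntegral.

(** * Scalar measures and sesquilinear integrals of a spectral measure *)

Section SpectralPositivity.
Variables (R : realType) (H : hilbertSpace R[i]).
Variables (d : measure_display) (T : measurableType d) (X : set T).
Variable E : set T -> H -> H.
Hypothesis sE : spectral_measure X E.
Local Notation C := R[i].

(** Countable additivity on a sequence of empty sets makes a constant series converge, so its term
    is 0. *)
Lemma spectral_set0 x : E set0 x = 0.
Proof.
have [_ _ sigma] := sE.
have m0 (k : nat) : trace_measurable X (set0 : set T).
  by exists set0; [exact: measurable0|rewrite set0I].
have triv : trivIset setT (fun _ : nat => set0 : set T).
  by apply/trivIsetP => i j _ _ _; rewrite setI0.
have /cvg_series_cvg_0 h0 : cvgn (series (fun _ : nat => E set0 x)).
  by apply/cvg_ex; eexists; exact: (sigma _ m0 triv x).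
apply: (@cvg_unique _ (@norm_hausdorff _ H) ((fun _ : nat => E set0 x) @ \oo)) => //.
exact: cvg_cst.
Qed.

Lemma scalar_measure_ge0 x U : measurable U -> (0 <= scalar_measure X E x U)%E.
Proof.
move=> mU; have [proj _ _] := sE.
have [_ idem sym] := proj (U `&` X) (ex_intro2 _ _ _ mU erefl).
rewrite lee_fin -[X in inner H X _]idem sym inner_norm.
have : 0 <= `|E (U `&` X) x| ^+ 2 by rewrite exprn_ge0.
by rewrite lecE => /andP[_].
Qed.

Lemma scalar_measure_out x U : U `&` X = set0 -> scalar_measure X E x U = 0%E.
Proof. by move=> UX; rewrite /scalar_measure UX spectral_set0 linear0l. Qed.

Lemma cintegral_scalar_ge0 x (f : T -> C) : (forall t, X t -> 0 <= f t) ->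
  let I := cintegral (scalar_measure X E x) f in
  0 <= complex.Re I /\ complex.Im I = 0.
Proof.
move=> f0 /=; split.
- apply: fine_ge0; apply: (@integral_ge0_on _ _ _ _ X) => [U mU|U _ UX|t /f0].
  + exact: scalar_measure_ge0.
  + exact: scalar_measure_out.
  + by rewrite lecE => /andP[_].
- rewrite (@integral_eq0_on _ _ _ _ X) // => [U mU|U _ UX|t /f0].
  + exact: scalar_measure_ge0.
  + exact: scalar_measure_out.
  + by rewrite lecE => /andP[/eqP].
Qed.

Lemma scalar_measure0 : scalar_measure X E 0 = fun U => 0%E.
Proof. by apply/funext => U; rewrite /scalar_measure linear0r. Qed.

Lemma cintegral0 (f : T -> C) : cintegral (fun _ : set T => 0%E) f = 0.
Proof.
have h (g : T -> R) : (\int[(fun _ : set T => 0%E)]_t (g t)%:E = 0)%E.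
  by apply: (@integral_eq0_on _ _ _ _ set0).
by rewrite /cintegral !h.
Qed.

(** For y = x the polarization term k = 2 vanishes and the terms k = 1 and k = 3 are purely
    imaginary, so the real part comes from the nonnegative term k = 0. *)
Lemma sesqui_integral_ge0 (f : T -> C) x : (forall t, X t -> 0 <= f t) ->
  0 <= complex.Re (sesqui_integral X E f x x).
Proof.
move=> f0; rewrite /sesqui_integral.
rewrite -(big_mkord xpredT (fun k => 'i ^+ k *
  cintegral (scalar_measure X E (x + 'i ^+ k *: x)) f)) !big_nat_recl // big_nil.
have I k := cintegral_scalar_ge0 (x + 'i ^+ k *: x) f0.
have -> : x + 'i ^+ 2 *: x = 0 by rewrite sqrCi scaleN1r subrr.
rewrite scalar_measure0 cintegral0 mulr0 addr0 add0r.
have -> : (4^-1 : C) = (4^-1 : R)%:C%C by rewrite fmorphV rmorph_nat.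
have := I 0%N; have := I 1%N; have := I 3%N; rewrite !exprS expr0.
do 3!case: (cintegral _ _) => ? ?.
move=> /= [_ ->] [_ ->] [a0 ->].

lra.
Qed.
End SpectralPositivity.

(** The pair of v and rho(b) v lies on the graph of the spectral integral, and v may itself be the
    test vector there; the inner product thus becomes a [sesqui_integral] at (v, v). *)
Lemma well_behaved_ge0 (R : realType) (A : gradedStarAlgType R[i])
    (K : hilbertSpace R[i]) (rho : starRep A K) (b : deg0 A) :
  well_behaved rho ->
  (forall chi, @positive_characters R A chi -> 0 <= chi b) ->
  forall v, rep_dom rho v -> 0 <= complex.Re (inner K (rep rho (val b) v) v).
Proof.
move=> [_ _ [E [sE eqE _]]] b0 v Dv.
have : closure (rep_graph rho (val b)) (v, rep rho (val b) v).
  by apply: subset_closure; exists v.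
rewrite eqE => -[/= dom /(_ v dom) ->].
exact: (sesqui_integral_ge0 sE).
Qed.

Lemma well_behaved_extension_ge0 (R : realType) (A : gradedStarAlgType R[i])
    (H K : hilbertSpace R[i]) (pi : starRep A H) (rho : starRep A K)
    (J : {linear H -> K}) (b : deg0 A) :
  well_behaved rho -> extends J rho pi ->
  (forall chi, @positive_characters R A chi -> 0 <= chi b) ->
  forall u, rep_dom pi u -> 0 <= complex.Re (inner H (rep pi (val b) u) u).
Proof.
move=> wb [iJ dJ eJ] b0 u Du; rewrite -iJ -eJ //.
exact: (well_behaved_ge0 wb b0 (dJ _ Du)).
Qed.

(** * Positive characters of the q-oscillator algebra *)

Section NumberOperator.
Variables (R : realType) (q : R).
Hypothesis q0 : 0 < q.
Local Notation C := R[i].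
Local Notation A := (qosc q).
Local Notation qC := (q%:C%C).
Local Notation a := (ann q).
Local Notation N := (cre q * ann q).

Lemma annX_gr n : a ^+ n \in gr n%:Z.
Proof.
have a1 : a \in gr 1 by apply/qdegP; exact: Qgr_ann.
elim: n => [|n IH]; first exact: gr1.
by rewrite exprS intS; exact: grM.
Qed.

Lemma star_annX n : star (a ^+ n) = cre q ^+ n.
Proof. by rewrite starX star_ann. Qed.

(** This is q N a = a (N - 1), the rule for moving N past a that yields the three identities
    below. *)
Lemma ann_number : qC *: (N * a) = a * N - a.
Proof. by rewrite mulrA qosc_relation mulrDl mul1r addrK -scalerAl. Qed.

Lemma number_annXX : qC ^+ 2 *: (N * a ^+ 2) = a ^+ 2 * (N - 1 - qC%:A).
Proof.
have -> : N * a ^+ 2 = (N * a) * a by rewrite expr2 -!mulrA.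
have -> : qC ^+ 2 *: (N * a * a) = qC *: ((qC *: (N * a)) * a).
  by rewrite expr2 -scalerA scalerAl.
have -> : qC *: (qC *: (N * a) * a) = a * (qC *: (N * a)) - qC *: (a * a).
  by rewrite ann_number mulrBl scalerBr -[a * N * a]mulrA scalerAr ann_number.
by rewrite ann_number !mulrBr mulr1 mulr_algr expr2 !mulrA.
Qed.

Lemma cre2_ann2 : qC *: (star (a ^+ 2) * a ^+ 2) = N * N - N.
Proof.
have -> : star (a ^+ 2) * a ^+ 2 = cre q * (N * a).
  by rewrite star_annX !expr2 -!mulrA.
by rewrite scalerAr ann_number mulrBr !mulrA.
Qed.

(** The inner a^* a is moved to the right past a^2 by [number_annXX], and [cre2_ann2] treats the
    remaining a^*^2 a^2. *)
Lemma cre3_ann3 : qC ^+ 3 *: (star (a ^+ 3) * a ^+ 3) =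
  (N * N - N) * (N - 1 - qC%:A).
Proof.
rewrite -cre2_ann2.
have -> : star (a ^+ 3) * a ^+ 3 = cre q ^+ 2 * (N * a ^+ 2).
  by rewrite star_annX exprSr exprS -!mulrA.
by rewrite exprS -scalerA scalerAr number_annXX star_annX -scalerAl !mulrA.
Qed.

Definition number : deg0 A := to0 N.
Lemma val_number : val number = N.
Proof.
apply: to0K; have := @gr_star _ A _ _ (annX_gr 1); rewrite star_annX expr1 => c1.
by rewrite -[0]/(- 1%:Z + 1%:Z); apply: grM => //; have := annX_gr 1; rewrite expr1.
Qed.

Lemma val_to0_star n : val (to0 (star (a ^+ n) * a ^+ n) : deg0 A) =
  star (a ^+ n) * a ^+ n.
Proof.
by apply: to0K; rewrite -(addNr n%:Z); apply: grM (annX_gr n); exact/gr_star/annX_gr.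
Qed.

Definition test_elt : deg0 A := (number - 1) * (number - (1 + qC)%:A).

Lemma val_test_elt : val test_elt = (N - 1) * (N - (1 + qC)%:A).
Proof. by rewrite rmorphM !rmorphB /= val_number. Qed.

(** With t = chi(N), positivity at a and a^3 gives t >= 0 and t (t - 1)(t - 1 - q) >= 0. For t > 0
    divide by t; for t = 0 the value of b is 1 + q. *)
Lemma test_elt_ge0 chi : @positive_characters R A chi -> 0 <= chi test_elt.
Proof.
move=> [[lin mul _ [x0 x0n]] pos].
have chi0 : chi 0 = 0.
  by have := lin (-1) 0 0; rewrite scaler0 addr0 mulN1r addNr.
have chiZ z x : chi (z *: x) = z * chi x by rewrite -[z *: x]addr0 lin chi0 addr0.
have chiB x y : chi (x - y) = chi x - chi y.
  by rewrite addrC -scaleN1r lin mulN1r addrC.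
have chi1 : chi 1 = 1.
  apply: (mulIf x0n); rewrite mul1r -mul mul1r //.
have p n : 0 <= chi (to0 (star (a ^+ n) * a ^+ n)) by apply: pos; exact: annX_gr.
pose t := chi number.
have t0 : 0 <= t.
  have := p 1%N; rewrite (_ : to0 _ = number) //.
  by apply: val_inj; rewrite val_to0_star val_number star_annX !expr1.
have t1 : 0 <= t * t - t.
  have -> : t * t - t = qC * chi (to0 (star (a ^+ 2) * a ^+ 2)).
    rewrite /t -mul -chiB -(chiZ qC); congr (chi _); apply: val_inj.
    by rewrite rmorphB rmorphM linearZ /= !val_number val_to0_star cre2_ann2.
  by rewrite mulr_ge0 // ler0c ltW.
have t2 : 0 <= (t * t - t) * (t - 1 - qC).
  have -> : (t * t - t) * (t - 1 - qC) =
      qC ^+ 3 * chi (to0 (star (a ^+ 3) * a ^+ 3)).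
    rewrite /t -mul -chiB -(chiZ (qC ^+ 3)).
    have -> : chi number - 1 - qC = chi (number - 1 - qC%:A).
      by rewrite !chiB chiZ chi1 mulr1.
    rewrite -mul.
    congr (chi _); apply: val_inj.
    rewrite rmorphM !rmorphB rmorphM !linearZ /= !val_number.
    by rewrite val_to0_star cre3_ann3 scalerN.
  by rewrite mulr_ge0 // exprn_ge0 // ler0c ltW.
have -> : chi test_elt = (t - 1) * (t - 1 - qC).
  by rewrite mul !chiB chiZ chi1 mulr1 opprD addrA.
(* A nonnegative complex number has imaginary part 0, so the inequalities descend to [R]. *)
case: (t) t0 t1 t2 => r i; rewrite lecE /= => /andP[/eqP-> r0].
have toC : (r +i* 0)%C = r%:C%C by [].
have e1 : r%:C%C * r%:C%C - r%:C%C = (r * r - r)%:C%C by rewrite rmorphB rmorphM.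
have e2 : r%:C%C - 1 - qC = (r - 1 - q)%:C%C by rewrite !rmorphB rmorph1.
have e3 : r%:C%C - 1 = (r - 1)%:C%C by rewrite rmorphB rmorph1.
rewrite toC e1 e2 e3 -!rmorphM !ler0c.
move=> h1 h2; have [r00|rn0] := eqVneq r 0.
  by rewrite r00; have := q0; nra.
have rp : 0 < r by rewrite lt_neqAle eq_sym rn0.
rewrite -(pmulr_rge0 _ rp) mulrA.
by rewrite (_ : r * (r - 1) = r * r - r) // mulrBr mulr1.
Qed.
End NumberOperator.

(** * The counterexample *)

Section WeightedRep.
Variables (R : realType) (q : R) (al be : nat -> nat -> R).
Variables (unpair : nat -> nat * nat) (pair : nat * nat -> nat).
Hypotheses (unpairK : cancel unpair pair) (pairK : cancel pair unpair).
Hypothesis be0 : forall j, be 0%N j = 0.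
Hypothesis al_be_diag : forall k j, before (fun i => al k i ^+ 2) j + be k.+1 j ^+ 2 =
  q * (al k j ^+ 2 + be k j ^+ 2) + 1.
Hypothesis al_be_off : forall k j, be k.+1 j * al k.+1 j = q * (al k j * be k.+1 j.+1).
Local Notation C := R[i].
Local Notation H := (l2_hilbert R).
Local Notation wop := (wop al be unpair pair).
Local Notation A := (qosc q).
Local Notation "\[ x ]" := (\pi_A x).

Definition wrep (x : A) (u : l2 R) : l2 R := wop (repr x) u.

(** Congruent expressions act alike by [wact_cong], so the choice of representative in [wrep] is
    immaterial. *)
Lemma wrep_pi (e : qexpr C) u : wrep \[e] u = wop e u.
Proof.
rewrite /wrep /wop.
by rewrite (wact_cong be0 al_be_diag al_be_off (qrepr q e)).
Qed.

Lemma wrep_lin z (x y : A) (u : l2 R) : finsupp u ->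
  wrep (z *: x + y) u = z *: wrep x u + wrep y u.
Proof.
move=> fu; elim/qosc_ind: x => x; elim/qosc_ind: y => y.
have -> : z *: \[x] + \[y] = \[Qadd (Qmul (Qconst z) x) y].
  by rewrite qoscD; congr (_ + _); exact: qscaleE.
rewrite !wrep_pi wop_add // wop_mul // wop_const //.
exact: finsupp_wop.
Qed.

Lemma wrep_mul (x y : A) (u : l2 R) : finsupp u -> wrep (x * y) u = wrep x (wrep y u).
Proof.
move=> fu; elim/qosc_ind: x => x; elim/qosc_ind: y => y.
by rewrite -qoscM !wrep_pi wop_mul.
Qed.

Lemma wrep_adj (x : A) (u v : l2 R) : finsupp u -> finsupp v ->
  inner H (wrep x u) v = inner H u (wrep (star x) v).
Proof.
move=> fu fv; elim/qosc_ind: x => x.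
have -> : star \[x] = \[qstar x] by exact: qoscstarE.
by rewrite !wrep_pi !l2_hilbert_innerE wop_adj.
Qed.

Definition weighted_rep : starRep A H.
Proof.
refine (@StarRep C A H [set u : l2 R | finsupp u] wrep _ _ _ _ _ _ _ _).
- exact: finsupp0.
- exact: finsupp_lin.
- exact: finsupp_dense.
- by move=> x u fu; exact: finsupp_wop.
- by move=> x z u v fu fv; exact: wop_lin.
- exact: wrep_lin.
- exact: wrep_mul.
- exact: wrep_adj.
Defined.

(** The unit acts as the identity, so each vector of the domain already lies in the span. *)
Lemma weighted_rep_nondegenerate : nondegenerate_rep weighted_rep.
Proof.
move=> u fu xs e e0; exists u; split.
  apply: sub_gen_smallest; exists 1, u => //.
  have -> : (1 : A) = \[Qconst 1] by rewrite qoscC scale1r.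
  by rewrite /= wrep_pi wop_const // scale1r.
split=> // x _; rewrite /graph_norm subrr normr0 add0r /= [wrep x 0]wop0 //.
by rewrite normr0.
Qed.

(** Here N e_{0,0} = al_{0,0}^2 e_{0,0} + al_{0,0} be_{1,1} e_{1,1}; a second N returns from e_{1,1}
    to e_{0,0} with the same factor al_{0,0} be_{1,1}, whence the extra summand. *)
Lemma weighted_rep_test :
  let e := to_l2 (delta_seq R (pair (0%N, 0%N))) in
  inner H (rep weighted_rep (val (test_elt q)) e) e =
  ((al 0%N 0%N ^+ 2 - 1) * (al 0%N 0%N ^+ 2 - 1 - q) +
   al 0%N 0%N ^+ 2 * be 1%N 1%N ^+ 2)%:C%C.
Proof.
move=> e; rewrite val_test_elt l2_hilbert_innerE inner_delta.
pose num : qexpr C := Qmul Qcre Qann.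
have -> : (cre q * ann q - 1) * (cre q * ann q - (1 + q%:C%C)%:A) =
    \[Qmul (Qadd num (Qconst (-1))) (Qadd num (Qconst (- (1 + q%:C%C))))].
  by rewrite !(qoscM, qoscD, qoscC) scaleN1r scaleNr.
have fe : finsupp e by rewrite to_l2K; exact: finsupp_delta.
rewrite [rep _ _ _]wrep_pi wopE //.
rewrite /flat pairK /e to_l2K; last exact: finsupp_delta.
rewrite /= /wcre /wann !(@delta_pair R _ _ pairK) //=.
by rewrite !(rmorphD, rmorphB, rmorphM, rmorphXn, rmorph1) /=; ring.
Qed.
End WeightedRep.

Theorem theorem2p5 (R : realType) (q : R) (q_gt0 : 0 < q) :
  exists (H : hilbertSpace R[i]) (pi : starRep (qosc q) H),
    nondegenerate_rep pi /\
    ~ exists (K : hilbertSpace R[i]) (rho : starRep (qosc q) K)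
        (J : {linear H -> K}), well_behaved rho /\ extends J rho pi.
Proof.
have [al [be [be0 diagE offE [al00 be11]]]] := weights_exist q_gt0.
have [unpair [pair [unpairK pairK]]] := nat_pairing.
pose pi := weighted_rep unpairK pairK be0 diagE offE.
exists (l2_hilbert R), pi; split; first exact: weighted_rep_nondegenerate.
move=> [K [rho [J [wb ext]]]].
pose e := to_l2 (delta_seq R (pair (0%N, 0%N))).
have De : rep_dom pi e by rewrite /= to_l2K; exact: finsupp_delta.
have := well_behaved_extension_ge0 wb ext (test_elt_ge0 q_gt0) De.
rewrite [inner _ _ _]weighted_rep_test /= al00 be11.
(* The inner product equals (q/2)(- q/2) + q^2 / 8 = - q^2 / 8. *)
by have := exprn_gt0 2 q_gt0; nra.
Qed.
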